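(* Let the inflow data $g$ be possibly nonhomogeneous, assume that the dissipation parameters $\alpha_e$ are uniformly bounded over all faces $e$, all $t\in[0,T]$ and all $\bm z\in e$, let $\varepsilon_1,\varepsilon_2\ge0$, and let $$\tau_{\mathrm{CFL}}:=\Bigl(\sup_{K\in\mathcal T,\ t\in[0,T]}\frac{1}{2|K|}\sum_{e\subset\partial K}\int_e\alpha_e(t,\bm z)\,\mathrm ds\Bigr)^{-1}\in(0,\infty]$$ (with $\tau_{\mathrm{CFL}}=\infty$ if the supremum vanishes). Let $\tau=T/N_T$ ($N_T\in\mathbb N$) with $0<\tau\le\tau_{\mathrm{CFL}}$. Let $(U^n)$ be the sequence generated by the rank-adaptive SAT scheme $U^{n+1}=\Phi_\tau(t^n,U^n;\varepsilon_1,\varepsilon_2)$ from an initial matrix $U^0$ (in SVD form), and let $(\hat U^n)$ be the sequence generated by the fully discrete forward Euler scheme $\hat U^{n+1}=\hat U^n+\tau F_h(t^n,\hat U^n)$ from an initial matrix $\hat U^0$, both using the same inflow data and the same time step $\tau$. Assume $\|U^0-\hat U^0\|_F\le\delta$ for some $\delta\ge0$. Then $$\|U^n-\hat U^n\|_F\le\delta+t^n\varepsilon_1+\frac{t^n}{\tau}\varepsilon_2\le\delta+T\varepsilon_1+\frac{T}{\tau}\varepsilon_2$$ for all $n$ with $t^n=n\tau\le T$.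
   Context: **Problem.** Let $d\ge1$, $T>0$, $\Omega^{(x)}\subset\mathbb R^d$ a bounded domain with piecewise linear (piecewise planar) boundary, $\Omega^{(v)}\subset\mathbb R^d$ a bounded polytope, $\Omega=\Omega^{(x)}\times\Omega^{(v)}$, $\bm z=(\bm x,\bm v)$. The electric field $\bm E\in C([0,T],W^{1,\infty}(\Omega^{(x)},\mathbb R^d))$ is prescribed and the phase-space velocity is $\bm a(t,\bm z)=(\bm v,-\bm E(t,\bm x))$, which satisfies $\nabla_{\bm z}\cdot\bm a=0$. The linear Vlasov equation is $\partial_t u+\nabla_{\bm z}\cdot(\bm a u)=0$ on $(0,T)\times\Omega$, with inflow data $u=g$ on the spatial inflow boundary (points of $\partial\Omega^{(x)}\times\Omega^{(v)}$ with $\bm n^{(x)}\cdot\bm v<0$) and $u=0$ on the velocity inflow boundary (points of $\Omega^{(x)}\times\partial\Omega^{(v)}$ with $-\bm n^{(v)}\cdot\bm E(t,\bm x)<0$); $g$ is extended by $0$ to the velocity inflow boundary. Here $\bm n^{(x)},\bm n^{(v)}$ are outward unit normals. The spatial inflow data are assumed to have a separated form $g(t,\bm x,\bm v)=\sum_{\nu=1}^{n_g}g_\nu^{(x)}(t,\bm x)g_\nu^{(v)}(t,\bm v)$ (with the boundary integrals below well defined). **Finite volume space.** $\mathcal T^{(x)}=\{K_i^{(x)}\}_{i=1}^{n^{(x)}}$ and $\mathcal T^{(v)}=\{K_j^{(v)}\}_{j=1}^{n^{(v)}}$ are finite meshes of $\Omega^{(x)}$, $\Omega^{(v)}$ consisting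 of open polytopal cells (possibly unstructured), and $\mathcal T=\{K_i^{(x)}\times K_j^{(v)}\}$ is the product mesh. A matrix $U=[u_{ij}]\in\mathbb R^{n^{(x)}\times n^{(v)}}$ is identified with the piecewise constant function $u_h$ having the value $u_h|_K=u_{ij}/\sqrt{|K|}$ on $K=K_i^{(x)}\times K_j^{(v)}$; thus $\|u_h\|_{L_2(\Omega)}=\|U\|_F$ (Frobenius norm). **Numerical fluxes.** Faces $e$ of cells are planar; $\bm n_{K,e}$ is the outward unit normal of $K$ on $e\subset\partial K$. For a cell $K$ and face $e\subset\partial K$ let $u^-$ be the value of $u_h$ in $K$, and $u^+$ the value of $u_h$ in the neighbouring cell across $e$ if $e$ is interior, or $u^+=g$ if $e\subset\partial\Omega$ (on the outflow part of a boundary face the exterior value is irrelevant, since its coefficient in the upwind flux vanishes). The flux is $$\hat f_e(t,\bm z,u^-,u^+,\bm n_{K,e})=\bm n_{K,e}\cdot\bm a(t,\bm z)\,\frac{u^-+u^+}{2}+\frac{\alpha_e(t,\bm z)}{2}(u^--u^+).$$ The dissipation parameter $\alpha_e$ is one of: upwind, $\alpha_e(t,\bm z)=|\bm n_e\cdot\bm a(t,\bm z)|$; local Lax–Friedrichs, $\alpha_e(t)$ constant on $e$ with $\alpha_e(t)\ge\max_{\bm z\in e}|\bm n_e\cdot\bm a(t,\bm z)|$; global Lax–Friedrichs, a common $\alpha(t)\ge\max_{e}\max_{\bm z\in e}|\bm n_e\cdot\bm a(t,\bm z)|$ for all faces on which this flux is applied. On all boundary faces $e\subset\partial\Omega$ the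 upwind choice is used. **Semi-discrete right-hand side.** $F_h(t,U)\in\mathbb R^{n^{(x)}\times n^{(v)}}$ is defined for $K=K_i^{(x)}\times K_j^{(v)}$ by $$[F_h(t,U)]_{ij}=-|K|^{-1/2}\sum_{e\subset\partial K}\int_e\hat f_e(t,\bm z,u^-,u^+,\bm n_{K,e})\,\mathrm ds .$$ It is affine-linear in $U$, $F_h(t,U)=L_h(t,U)+B_h(t)$, where $L_h(t,\cdot)$ is linear (the case $g=0$) and $B_h(t)$ collects the inflow data. **Rank-adaptive SAT scheme.** $t^n=n\tau$, $\tau=T/N_T$, $n=0,\dots,N_T$. For $\varepsilon\ge0$ and a matrix $M$, $\mathcal T^{\mathrm{svd}}_\varepsilon(M)=Y\Sigma Z^\top$ denotes a truncated singular value decomposition of $M$ (keeping leading singular values and vectors), with $Y^\top Y=I$, $Z^\top Z=I$, $\|Y\Sigma Z^\top-M\|_F\le\varepsilon$ and $\|Y\Sigma Z^\top\|_F\le\|M\|_F$. $\operatorname{ortho}[A,B]$ denotes a matrix whose columns form an orthonormal basis of the column span of $[A,B]$. ''SVD form'' of $U^n$ means $U^n=X^nS^nV^{n,\top}$ with $X^n,V^n$ having orthonormal columns and $S^n$ square diagonal with nonnegative entries. One step $U^{n+1}=\Phi_\tau(t^n,U^n;\varepsilon_1,\varepsilon_2)$ is: 1. $\bar X\bar S\bar V^\top=\mathcal T^{\mathrm{svd}}_{\varepsilon_1}(F_h(t^n,U^n))$; 2. $\tilde X=\operatorname{ortho}[X^n,\bar X]$, $\tilde V=\operatorname{ortho}[V^n,\bar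 V]$; 3. $\tilde S^n=(\tilde X^\top X^n)S^n(\tilde V^\top V^n)^\top$, $\tilde S^{n+1}=\tilde S^n+\tau\,\tilde X^\top F_h(t^n,U^n)\tilde V$; 4. $U^{n+1}=X^{n+1}S^{n+1}V^{n+1,\top}=\mathcal T^{\mathrm{svd}}_{\varepsilon_2}(\tilde X\tilde S^{n+1}\tilde V^\top)$. *)

(* Defs.v *)
From HB Require Import structures.
From mathcomp Require Import all_boot all_order all_algebra.
From mathcomp Require Import all_classical all_reals all_analysis.

Set Implicit Arguments.
Unset Strict Implicit.
Unset Printing Implicit Defensive.

Import Order.TTheory GRing.Theory Num.Theory.
Import numFieldNormedType.Exports.

Local Open Scope classical_set_scope.
Local Open Scope ring_scope.

Fact rv_display : measure_display -> measure_display.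
Proof. exact. Qed.

(* The sigma-algebra on ['rV[R]_n] is generated by the coordinates, i.e. it is
   the Borel sigma-algebra, as for the library's [n.-tuple T]. *)
Section rv_measurable.
Context (R : realType) (n : nat).

Let coor (i : 'I_n) (x : 'rV[R]_n) : R := x ord0 i.

Let rv_set0 : g_sigma_preimage coor set0.
Proof. exact: sigma_algebra0. Qed.

Let rv_setC A : g_sigma_preimage coor A -> g_sigma_preimage coor (~` A).
Proof. exact: sigma_algebraC. Qed.

Let rv_bigcup (F : _^nat) : (forall i, g_sigma_preimage coor (F i)) ->
  g_sigma_preimage coor (\bigcup_i (F i)).
Proof. exact: sigma_algebra_bigcup. Qed.

HB.instance Definition _ :=
  @isMeasurable.Build (rv_display default_measure_display)
    'rV[R]_n (g_sigma_preimage coor) rv_set0 rv_setC rv_bigcup.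

Lemma measurable_coor (i : 'I_n) :
  measurable_fun [set: 'rV[R]_n] (fun x : 'rV[R]_n => x ord0 i).
Proof.
move=> _ Y mY; rewrite setTI; apply: sub_sigma_algebra => /=.
rewrite -bigcup_seq/=; exists i => /=; first by rewrite mem_index_enum.
by exists Y => //; rewrite setTI.
Qed.

Lemma measurable_fun_coorP d (T : measurableType d) (f : T -> 'rV[R]_n) :
  (forall i, measurable_fun [set: T] (fun x => f x ord0 i)) ->
  measurable_fun [set: T] f.
Proof.
move=> mf; suff H : g_sigma_preimage (fun i x => coor i (f x)) `<=` measurable.
  move=> _ A mA; rewrite setTI; apply: H.
  by rewrite (g_sigma_preimage_comp coor f); exists A => //; rewrite setTI.
apply: smallest_sub; first exact: sigma_algebra_measurable.
move=> A; rewrite -bigcup_seq/= => -[i _] [B mB <-].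
by have := mf i measurableT B mB.
Qed.
End rv_measurable.

Section rv_measure_succ.
Context (R : realType) (n : nat) (mu : {sigma_finite_measure set 'rV[R]_n -> \bar R}).

Definition rv_cons (p : measurableTypeR R * 'rV[R]_n) : 'rV[R]_n.+1 :=
  \row_i oapp (p.2 ord0) p.1 (unlift ord0 i).

Definition rv_uncons (x : 'rV[R]_n.+1) : measurableTypeR R * 'rV[R]_n :=
  (x ord0 ord0, \row_i x ord0 (lift ord0 i)).

Lemma rv_consK : cancel rv_cons rv_uncons.
Proof.
move=> [a y]; rewrite /rv_uncons /rv_cons mxE unlift_none /=; congr pair.
by apply/rowP => i; rewrite !mxE liftK.
Qed.

Lemma rv_unconsK : cancel rv_uncons rv_cons.
Proof.
move=> x; apply/rowP => i; rewrite mxE.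
by case: unliftP => [j ->|->] //=; rewrite mxE.
Qed.

Lemma measurable_rv_cons : measurable_fun [set: _] rv_cons.
Proof.
apply: measurable_fun_coorP => i; rewrite /rv_cons.
under eq_fun do rewrite mxE.
case: unliftP => [j _|_] /=; last exact: measurable_fst.
exact: (measurableT_comp (measurable_coor j) measurable_snd).
Qed.

Lemma measurable_rv_uncons : measurable_fun [set: _] rv_uncons.
Proof.
apply/measurable_fun_pairP; split; first exact: measurable_coor.
apply: measurable_fun_coorP => i; rewrite /rv_uncons /=.
under eq_fun do rewrite mxE.
exact: measurable_coor.
Qed.

Definition rv_measure_succ : set 'rV[R]_n.+1 -> \bar R :=
  pushforward (lebesgue_measure \x mu)%E rv_cons.

Let rv_measure_succ0 : rv_measure_succ set0 = 0%E.
Proof. by rewrite /rv_measure_succ /pushforward preimage_set0 measure0. Qed.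

Let rv_measure_succ_ge0 A : (0 <= rv_measure_succ A)%E.
Proof. exact: (measure_ge0 (lebesgue_measure \x mu)%E). Qed.

Let rv_measure_succ_sigma_additive : semi_sigma_additive rv_measure_succ.
Proof.
exact: (@measure_semi_sigma_additive _ _ _
  (measure_function_pushforward__canonical__measure_function_Measure
    (lebesgue_measure \x mu)%E measurable_rv_cons)).
Qed.

HB.instance Definition _ := isMeasure.Build _ _ _ rv_measure_succ
  rv_measure_succ0 rv_measure_succ_ge0 rv_measure_succ_sigma_additive.

Let rv_measure_succ_sigma_finite : sigma_finite setT rv_measure_succ.
Proof.
have /sigma_finiteP[F [TF ndF Foo]] := sigma_finiteT (@lebesgue_measure R).
have /sigma_finiteP[G [TG ndG Goo]] := sigma_finiteT mu.
exists (fun k => rv_uncons @^-1` (F k `*` G k)).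
  apply/esym; rewrite -subTset => x _.
  have [i _ Fi] : (\bigcup_i F i) (rv_uncons x).1 by rewrite -TF.
  have [j _ Gj] : (\bigcup_i G i) (rv_uncons x).2 by rewrite -TG.
  exists (maxn i j) => //; split.
  - by move: Fi; exact/subsetPset/ndF/leq_maxl.
  - by move: Gj; exact/subsetPset/ndG/leq_maxr.
move=> k; have [mF Fk] := Foo k; have [mG Gk] := Goo k; split.
  rewrite -[X in measurable X]setTI; apply: measurable_rv_uncons => //.
  exact: measurableX.
rewrite /rv_measure_succ /pushforward.
rewrite (_ : rv_cons @^-1` _ = F k `*` G k).
  by rewrite product_measure1E// lte_mul_pinfty// ge0_fin_numE.
by rewrite -comp_preimage (_ : _ \o _ = id) //; apply/funext => x; exact: rv_consK.
Qed.

HB.instance Definition _ := Measure_isSigmaFinite.Build _ _ _ rv_measure_succ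
  rv_measure_succ_sigma_finite.

End rv_measure_succ.

(* [leb 0] is the point mass on the one-point space ['rV_0]; [leb n.+1] is the
   product of the Lebesgue measure on [R] and [leb n]. *)
Fixpoint leb (R : realType) (n : nat) :
    {sigma_finite_measure set 'rV[R]_n -> \bar R} :=
  match n with
  | 0 => \d_(0 : 'rV[R]_0)
  | m.+1 => rv_measure_succ (leb R m)
  end.

Section sobolev.
Context (R : realType) (d : nat).
Implicit Types (Omega : set 'rV[R]_d) (f w phi : 'rV[R]_d -> R).

Definition partial (i : 'I_d) f (x : 'rV[R]_d) : R :=
  'D_(delta_mx ord0 i) f x.

Fixpoint Ck (k : nat) f : Prop :=
  match k with
  | 0 => continuous f
  | m.+1 => continuous f /\
      forall i, (forall x, derivable f x (delta_mx ord0 i)) /\ Ck m (partial i f)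
  end.

Definition test_function Omega phi : Prop :=
  (forall k, Ck k phi) /\
  exists K : set 'rV[R]_d,
    [/\ compact K, K `<=` Omega & forall x, ~ K x -> phi x = 0].

Definition weak_partial Omega (i : 'I_d) f w : Prop :=
  forall phi, test_function Omega phi ->
    \int[leb R d]_(x in Omega) (f x * partial i phi x) =
    - \int[leb R d]_(x in Omega) (w x * phi x).

Definition Loo_ball Omega (c : R) f : Prop :=
  measurable_fun Omega f /\ {ae leb R d, forall x, Omega x -> `|f x| <= c}.

(* The [W^{1,oo}] norm is the maximum of the [L^oo] norms of the function and
   of its first weak derivatives. *)
Definition W1oo_ball Omega (c : R) f : Prop :=
  Loo_ball Omega c f /\
  forall i, exists w, Loo_ball Omega c w /\ weak_partial Omega i f w.

(* No representative of [E t] is singled out; in particular the Lipschitz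
   continuous one is allowed. *)
Definition C_W1oo (T : R) Omega (E : R -> 'rV[R]_d -> 'rV[R]_d) : Prop :=
  forall t, 0 <= t <= T -> forall k : 'I_d,
    (exists c, W1oo_ball Omega c (fun x => E t x ord0 k)) /\
    forall eps, 0 < eps -> exists2 eta, 0 < eta &
      forall s, 0 <= s <= T -> `|s - t| < eta ->
        W1oo_ball Omega eps (fun x => E s x ord0 k - E t x ord0 k).

End sobolev.

Section geometry.
Context (R : realType).

Definition dot n (x y : 'rV[R]_n) : R := (x *m y^T) ord0 ord0.

Definition bdry n (A : set 'rV[R]_n) : set 'rV[R]_n := closure A `\` interior A.

Definition conv_hull n (s : seq 'rV[R]_n) : set 'rV[R]_n :=
  [set x | exists w : 'I_(size s) -> R,
    [/\ forall i, 0 <= w i, \sum_i w i = 1 & x = \sum_i w i *: s`_i]].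

Definition polyhedron n (ss : seq (seq 'rV[R]_n)) : set 'rV[R]_n :=
  \bigcup_(s in [set` ss]) conv_hull s.

(* Open polytopes are not assumed to be convex. *)
Definition open_polytope n (P : set 'rV[R]_n) : Prop :=
  P !=set0 /\ exists ss, P = interior (polyhedron ss).

Definition hyperplane n (H : set 'rV[R]_n) : Prop :=
  exists (m : 'rV[R]_n) (c : R), m != 0 /\ H = [set x | dot m x = c].

Definition pl_domain n (Omega : set 'rV[R]_n) : Prop :=
  [/\ open Omega, connected Omega, Omega !=set0, bounded_set Omega &
    exists2 ss : seq (seq 'rV[R]_n), bdry Omega = polyhedron ss &
      forall s, s \in ss -> exists2 H, hyperplane H & conv_hull s `<=` H].

(* A face [f] is the image of the open polytope [fdom f] of [R^(d-1)] under the
   isometry [y |-> fbase f + y *m fframe f] of [R^(d-1)] onto a hyperplane with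
   unit normal [fnormal f].  The normal points out of the cell [inner f];
   [outer f] is the cell on the other side, [None] for a boundary face.  A
   planar side of a cell may be split into several faces (hanging nodes). *)
Record mesh (d : nat) := Mesh {
  ncells : nat;
  cell : 'I_ncells -> set 'rV[R]_d;
  nfaces : nat;
  fdom : 'I_nfaces -> set 'rV[R]_d.-1;
  fbase : 'I_nfaces -> 'rV[R]_d;
  fframe : 'I_nfaces -> 'M[R]_(d.-1, d);
  fnormal : 'I_nfaces -> 'rV[R]_d;
  inner : 'I_nfaces -> 'I_ncells;
  outer : 'I_nfaces -> option 'I_ncells
}.

Context (d : nat).
Implicit Types (M : mesh d) (Omega : set 'rV[R]_d).

Definition fpar M (f : 'I_(nfaces M)) (y : 'rV[R]_d.-1) : 'rV[R]_d :=
  fbase f + y *m fframe f.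

Definition face M (f : 'I_(nfaces M)) : set 'rV[R]_d := fpar f @` fdom f.

Definition face_of M (i : 'I_(ncells M)) (f : 'I_(nfaces M)) : bool :=
  (inner f == i) || (outer f == Some i).

Definition outward_on (K e : set 'rV[R]_d) (m : 'rV[R]_d) : Prop :=
  forall z, e z -> exists2 r, 0 < r &
    forall s, 0 < s < r -> K (z - s *: m) /\ ~ K (z + s *: m).

Definition wf_face Omega M (f : 'I_(nfaces M)) : Prop :=
  [/\ open_polytope (fdom f),
      [/\ fframe f *m (fframe f)^T = 1%:M,
          fframe f *m (fnormal f)^T = 0 & dot (fnormal f) (fnormal f) = 1],
      face f `<=` bdry (cell (inner f)) /\
        outward_on (cell (inner f)) (face f) (fnormal f) &
      match outer f with
      | Some j => [/\ face f `<=` Omega, face f `<=` bdry (cell j) &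
                      outward_on (cell j) (face f) (- fnormal f)]
      | None => face f `<=` bdry Omega
      end].

Definition is_mesh Omega M : Prop :=
  [/\ forall i : 'I_(ncells M), open_polytope (cell i) /\ cell i `<=` Omega,
      forall i j : 'I_(ncells M), i != j -> cell i `&` cell j = set0,
      closure Omega = \bigcup_(i : 'I_(ncells M)) closure (cell i),
      forall f : 'I_(nfaces M), wf_face Omega f &
      forall i : 'I_(ncells M),
        bdry (cell i) = \bigcup_(f in [set f | face_of i f]) closure (face f) /\
        forall f f', face_of i f -> face_of i f' -> f != f' ->
          face f `&` face f' = set0].

End geometry.

Inductive flux_kind := Upwind | LocalLF | GlobalLF.

Section finite_volume.
Context (R : realType) (d : nat) (Mx Mv : mesh R d).

Definition phase : Type := ('rV[R]_d * 'rV[R]_d)%type.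

Definition pdot (a b : phase) : R := dot a.1 b.1 + dot a.2 b.2.

Definition pcell : Type := ('I_(ncells Mx) * 'I_(ncells Mv))%type.

Definition pcell_set (K : pcell) : set phase := cell K.1 `*` cell K.2.

Definition vol (K : pcell) : R := fine ((leb R d \x leb R d)%E (pcell_set K)).

(* The faces of [K_i * K_j] are the [e * K_j] and the [K_i * e], with [e] a face
   of [K_i], respectively of [K_j]. *)
Definition pface : Type :=
  ('I_(nfaces Mx) * 'I_(ncells Mv) + 'I_(ncells Mx) * 'I_(nfaces Mv))%type.

Definition pface_set (e : pface) : set phase :=
  match e with
  | inl (f, j) => face f `*` cell j
  | inr (i, f) => cell i `*` face f
  end.

Definition pnormal (e : pface) : phase :=
  match e with
  | inl (f, _) => (fnormal f, 0)
  | inr (_, f) => (0, fnormal f)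
  end.

Definition pinner (e : pface) : pcell :=
  match e with
  | inl (f, j) => (inner f, j)
  | inr (i, f) => (i, inner f)
  end.

Definition pouter (e : pface) : option pcell :=
  match e with
  | inl (f, j) => omap (fun i => (i, j)) (outer f)
  | inr (i, f) => omap (fun j => (i, j)) (outer f)
  end.

Definition pface_of (K : pcell) (e : pface) : bool :=
  (pinner e == K) || (pouter e == Some K).

Definition outnormal (K : pcell) (e : pface) : phase :=
  if pinner e == K then pnormal e else - pnormal e.

Definition neighbour (K : pcell) (e : pface) : option pcell :=
  if pinner e == K then pouter e else Some (pinner e).

(* The surface measure of a face is the image of the Lebesgue measure under its
   isometric parametrization. *)
Definition face_int (e : pface) (h : phase -> R) : R :=
  match e with
  | inl (f, j) => \int[(leb R d.-1 \x leb R d)%E]_(p in fdom f `*` cell j)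
                    h (fpar f p.1, p.2)
  | inr (i, f) => \int[(leb R d \x leb R d.-1)%E]_(p in cell i `*` fdom f)
                    h (p.1, fpar f p.2)
  end.

Definition face_integrable (e : pface) (h : phase -> R) : Prop :=
  match e with
  | inl (f, j) => (leb R d.-1 \x leb R d)%E.-integrable (fdom f `*` cell j)
                    (fun p => (h (fpar f p.1, p.2))%:E)
  | inr (i, f) => (leb R d \x leb R d.-1)%E.-integrable (cell i `*` fdom f)
                    (fun p => (h (p.1, fpar f p.2))%:E)
  end.

Context (E : R -> 'rV[R]_d -> 'rV[R]_d).

Definition velocity (t : R) (z : phase) : phase := (z.2, - E t z.1).

(* [lloc] and [lglob] are the local and global Lax-Friedrichs parameters. *)
Definition dissipation (kind : pface -> flux_kind) (lloc : R -> pface -> R)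
    (lglob : R -> R) (t : R) (e : pface) (z : phase) : R :=
  match kind e with
  | Upwind => `|pdot (pnormal e) (velocity t z)|
  | LocalLF => lloc t e
  | GlobalLF => lglob t
  end.

Definition admissible_flux (T : R) (kind : pface -> flux_kind)
    (lloc : R -> pface -> R) (lglob : R -> R) : Prop :=
  (forall e, pouter e = None -> kind e = Upwind) /\
  forall t e z, 0 <= t <= T -> pface_set e z ->
    (kind e = LocalLF -> `|pdot (pnormal e) (velocity t z)| <= lloc t e) /\
    (kind e = GlobalLF -> `|pdot (pnormal e) (velocity t z)| <= lglob t).

Definition separated_inflow (ng : nat) (gx gv : 'I_ng -> R -> 'rV[R]_d -> R)
    (t : R) (z : phase) : R :=
  \sum_nu gx nu t z.1 * gv nu t z.2.

Context (alpha : R -> pface -> phase -> R) (g : R -> phase -> R).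

Definition inflow_value (t : R) (e : pface) (z : phase) : R :=
  if e is inl _ then g t z else 0.

(* On a boundary face the upwind flux depends on the exterior value only through
   [min (n . a) 0] times that value, with [n] the outward normal. *)
Definition inflow_integrable (T : R) : Prop :=
  forall t e, 0 <= t <= T -> pouter e = None ->
    face_integrable e (fun z =>
      Num.min (pdot (pnormal e) (velocity t z)) 0 * inflow_value t e z).

Definition num_flux (a m : phase) (alpha_e um up : R) : R :=
  pdot m a * ((um + up) / 2) + alpha_e / 2 * (um - up).

Definition uval (U : 'M[R]_(ncells Mx, ncells Mv)) (K : pcell) : R :=
  U K.1 K.2 / Num.sqrt (vol K).

Definition uplus (U : 'M[R]_(ncells Mx, ncells Mv)) (t : R) (K : pcell)
    (e : pface) (z : phase) : R :=
  if neighbour K e is Some K' then uval U K' else inflow_value t e z.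

Definition Fh (t : R) (U : 'M[R]_(ncells Mx, ncells Mv)) :
    'M[R]_(ncells Mx, ncells Mv) :=
  \matrix_(i, j) let K := (i, j) in
    - (Num.sqrt (vol K))^-1 * \sum_(e | pface_of K e) face_int e (fun z =>
        num_flux (velocity t z) (outnormal K e) (alpha t e z)
          (uval U K) (uplus U t K e z)).

Definition cfl_rate (t : R) (K : pcell) : R :=
  (2 * vol K)^-1 * \sum_(e | pface_of K e) face_int e (alpha t e).

(* The library's inverse on [\bar R] satisfies [0^-1 = +oo]. *)
Definition tau_CFL (T : R) : \bar R :=
  ((ereal_sup [set y | exists (t : R) (K : pcell),
     (0 <= t <= T)%R /\ y = (cfl_rate t K)%:E])^-1)%E.

End finite_volume.

Section low_rank.
Context (R : realType).

Definition frob m n (A : 'M[R]_(m, n)) : R := Num.sqrt (\sum_i \sum_j A i j ^+ 2).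

Record factored (m n : nat) := Factored {
  rk : nat;
  fX : 'M[R]_(m, rk);
  fS : 'M[R]_rk;
  fV : 'M[R]_(n, rk)
}.

Context (m n : nat).
Implicit Types (u : factored m n) (A : 'M[R]_(m, n)).

Definition fval u : 'M[R]_(m, n) := fX u *m fS u *m (fV u)^T.

Definition svd_form u : Prop :=
  [/\ (fX u)^T *m fX u = 1%:M, (fV u)^T *m fV u = 1%:M,
      is_diag_mx (fS u) & forall i, 0 <= fS u i i].

(* [w] carries the discarded singular values and vectors of [A]. *)
Definition truncated_svd (eps : R) A u : Prop :=
  [/\ svd_form u,
      exists w, [/\ svd_form w, A = fval u + fval w,
        (fX u)^T *m fX w = 0, (fV u)^T *m fV w = 0 &
        forall i j, fS w j j <= fS u i i],
      frob (fval u - A) <= eps & frob (fval u) <= frob A].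

Definition is_ortho k p q r (A : 'M[R]_(k, p)) (B : 'M[R]_(k, q))
    (Q : 'M[R]_(k, r)) : Prop :=
  Q^T *m Q = 1%:M /\ (Q^T == (row_mx A B)^T)%MS.

Definition SAT_step (F : 'M[R]_(m, n) -> 'M[R]_(m, n)) (tau eps1 eps2 : R)
    (u u' : factored m n) : Prop :=
  exists (b : factored m n) (rx rv : nat)
         (X : 'M[R]_(m, rx)) (V : 'M[R]_(n, rv)),
    let S0 := (X^T *m fX u) *m fS u *m (V^T *m fV u)^T in
    let S1 := S0 + tau *: (X^T *m F (fval u) *m V) in
    [/\ truncated_svd eps1 (F (fval u)) b,
        is_ortho (fX u) (fX b) X, is_ortho (fV u) (fV b) V &
        truncated_svd eps2 (X *m S1 *m V^T) u'].

End low_rank.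

(* Main.v *)
Require Import Defs.
From HB Require Import structures.
From mathcomp Require Import all_boot all_order all_algebra.
From mathcomp Require Import all_classical all_reals all_analysis.
From mathcomp Require Import measurable_realfun ring lra.

Set Implicit Arguments.
Unset Strict Implicit.
Unset Printing Implicit Defensive.

Import Order.TTheory GRing.Theory Num.Theory.
Import numFieldNormedType.Exports.

Local Open Scope classical_set_scope.
Local Open Scope ring_scope.

(** A step of the rank-adaptive scheme differs from a forward Euler step from the
    same state by the two truncation errors only, and a forward Euler step does not
    increase the distance between two states.  Summing the errors over the steps
    gives the bound.

    The first point is linear algebra ([SAT_step_error]): the augmented bases span
    the current iterate, which is therefore reproduced exactly, and they span the
    truncated right-hand side, so that projecting the full right-hand side onto them
    is at least as accurate as the truncation.

    For the second point ([euler_contraction]), subtract the Euler steps of two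
    states; the inflow data cancel.  On every face the numerical flux is the outflow
    rate [int (alpha + n.a) / 2] times the inner value minus the inflow rate
    [int (alpha - n.a) / 2] times the outer value, and both rates are nonnegative
    because [alpha] dominates the normal velocity.  The velocity field has no net flux
    through a cell ([net_flux]), so the rates of either kind sum to [r_K], half the
    integral of [alpha] over the boundary of the cell.  The updated value is then
    [(1 - tau r_K / |K|) u_K] plus the inflow rates times [tau / |K|] against the
    neighbouring values: under the time step restriction, a convex combination.
    Since what flows into a cell has left its neighbour, convexity of the square
    makes the volume-weighted sum of squares nonincreasing ([update_contraction]).

    The normal velocity on a face of a product cell depends on the variable of the
    other factor only, so that [net_flux] reduces to a fact about each factor: the
    outward normals of the faces of a polytopal cell, weighted by the areas of the
    faces, sum to zero ([faces_balance]).  The cells need not be convex, and the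
    faces are only known to cover the boundary, so the proof counts crossings.  Almost
    every line parallel to a coordinate axis meets the boundary of the cell in
    finitely many points, each in the interior of a face transversal to the line, and
    it enters the cell as often as it leaves it ([balanced_crossings]).  Integrating
    the signed number of crossings over all these lines gives the corresponding
    component of the sum, because the projection along the axis multiplies the area of
    a face by the modulus of that component of its normal ([leb_shadow], from the
    linear change of variables [leb_affine]).  The exceptional lines form a null set,
    since the boundary of a polytope lies in finitely many hyperplanes
    ([open_polytope_boundary_null]). *)

(** * Frobenius norm and the low-rank step *)

Section frobenius.
Context (R : realType).

Definition fdot m n (A B : 'M[R]_(m, n)) : R := \tr (A^T *m B).

Lemma fdotE m n (A B : 'M[R]_(m, n)) :
  fdot A B = \sum_i \sum_j A i j * B i j.
Proof.
rewrite /fdot /mxtrace exchange_big /=; apply: eq_bigr => j _.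
by rewrite mxE; apply: eq_bigr => i _; rewrite mxE.
Qed.

Lemma frobE m n (A : 'M[R]_(m, n)) : frob A = Num.sqrt (fdot A A).
Proof. by rewrite /frob fdotE. Qed.

Lemma fdot_ge0 m n (A : 'M[R]_(m, n)) : 0 <= fdot A A.
Proof.
by rewrite fdotE; apply: sumr_ge0 => i _; apply: sumr_ge0 => j _; rewrite -expr2 sqr_ge0.
Qed.

Lemma sqr_frob m n (A : 'M[R]_(m, n)) : frob A ^+ 2 = fdot A A.
Proof. by rewrite frobE sqr_sqrtr// fdot_ge0. Qed.

Lemma frob_ge0 m n (A : 'M[R]_(m, n)) : 0 <= frob A.
Proof. exact: sqrtr_ge0. Qed.

Lemma fdotC m n (A B : 'M[R]_(m, n)) : fdot A B = fdot B A.
Proof. by rewrite /fdot -mxtrace_tr trmx_mul trmxK. Qed.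

Lemma fdotDr m n (A B C : 'M[R]_(m, n)) : fdot A (B + C) = fdot A B + fdot A C.
Proof. by rewrite /fdot mulmxDr mxtraceD. Qed.

Lemma fdotZr m n (c : R) (A B : 'M[R]_(m, n)) : fdot A (c *: B) = c * fdot A B.
Proof. by rewrite /fdot -scalemxAr mxtraceZ. Qed.

Lemma fdotDZ m n (a b : R) (A B : 'M[R]_(m, n)) :
  fdot (a *: A + b *: B) (a *: A + b *: B) =
  a ^+ 2 * fdot A A + 2 * a * b * fdot A B + b ^+ 2 * fdot B B.
Proof.
rewrite fdotDr !fdotZr ![fdot (_ + _) _]fdotC !fdotDr !fdotZr (fdotC B A); ring.
Qed.

Lemma fdot_le m n (A B : 'M[R]_(m, n)) : fdot A B <= frob A * frob B.
Proof.
have [a0 b0] := (frob_ge0 A, frob_ge0 B).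
have := fdot_ge0 (frob B *: A + (- frob A) *: B).
rewrite fdotDZ -!sqr_frob.
set a := frob A; set b := frob B; set c := fdot A B => h.
have [ab0|] := ltrP 0 (a * b).
  have : 0 <= (a * b) * (a * b - c) by nra.
  by rewrite pmulr_rge0// subr_ge0.
(* when one of the two norms vanishes, the matrix itself is zero *)
move=> ab0; suff -> : c = 0 by rewrite mulr_ge0.
have z0 (M N : 'M[R]_(m, n)) : frob M = 0 -> fdot M N = 0.
  move=> M0; have : fdot M M = 0 by rewrite -sqr_frob M0 expr0n.
  rewrite !fdotE => /eqP; rewrite psumr_eq0; last first.
    by move=> i _; apply: sumr_ge0 => j _; rewrite -expr2 sqr_ge0.
  move=> /allP Mi; apply: big1 => i _; apply: big1 => j _.
  have := Mi i (mem_index_enum _); rewrite psumr_eq0; last first.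
    by move=> k _; rewrite -expr2 sqr_ge0.
  move=> /allP/(_ j (mem_index_enum _)); rewrite mulf_eq0 orbb => /eqP ->.
  by rewrite mul0r.
have : a * b == 0 by rewrite eq_le ab0 mulr_ge0.
rewrite mulf_eq0 /c => /orP[]/eqP/z0 h0; last by rewrite fdotC h0.
exact: h0.
Qed.

Lemma frobD m n (A B : 'M[R]_(m, n)) : frob (A + B) <= frob A + frob B.
Proof.
rewrite -ler_sqr ?nnegrE ?addr_ge0 ?frob_ge0// sqr_frob.
have := fdotDZ 1 1 A B; rewrite !scale1r => ->.
have := fdot_le A B; have := sqr_frob A; have := sqr_frob B; nra.
Qed.

Lemma frobZ m n (c : R) (A : 'M[R]_(m, n)) : 0 <= c -> frob (c *: A) = c * frob A.
Proof.
move=> c0; rewrite !frobE fdotZr fdotC fdotZr mulrA -expr2.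
by rewrite sqrtrM ?sqr_ge0// sqrtr_sqr ger0_norm.
Qed.

Lemma frobN m n (A : 'M[R]_(m, n)) : frob (- A) = frob A.
Proof.
by rewrite !frobE !fdotE; congr Num.sqrt; do 2 (apply: eq_bigr => ? _); rewrite !mxE mulrNN.
Qed.

Lemma frob_leP m n (A B : 'M[R]_(m, n)) :
  (frob A <= frob B) = (fdot A A <= fdot B B).
Proof. by rewrite !frobE ler_sqrt// fdot_ge0. Qed.

(** Two-sided compression onto the column spans of [X] and [V] is an orthogonal
    projection for the trace inner product, so its complement is a contraction. *)
Lemma frob_compression m n k l (X : 'M[R]_(m, k)) (V : 'M[R]_(n, l))
    (G : 'M[R]_(m, n)) : X^T *m X = 1%:M -> V^T *m V = 1%:M ->
  frob (X *m X^T *m G *m (V *m V^T) - G) <= frob G.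
Proof.
move=> XX VV; set p := X *m X^T; set q := V *m V^T.
have [pp qq] : p *m p = p /\ q *m q = q.
  by rewrite /p /q -!mulmxA (mulmxA X^T) XX (mulmxA V^T) VV !mul1mx.
have [pT qT] : p^T = p /\ q^T = q by rewrite /p /q !trmx_mul !trmxK.
clearbody p q.
set P := p *m G *m q; suff h : fdot P P = fdot P G.
  rewrite frob_leP; have := fdotDZ 1 (-1) P G; rewrite !scale1r !scaleN1r => ->.
  have := fdot_ge0 P; lra.
rewrite /fdot /P !trmx_mul pT qT !mulmxA mxtrace_mulC !mulmxA qq.
by rewrite -(mulmxA _ p p) pp.
Qed.

Lemma is_ortho_proj k p q r (A : 'M[R]_(k, p)) (B : 'M[R]_(k, q))
    (Q : 'M[R]_(k, r)) : is_ortho A B Q ->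
  Q *m Q^T *m A = A /\ Q *m Q^T *m B = B.
Proof.
move=> [QQ /andP[_ /submxP[C hC]]].
have h : row_mx A B = Q *m C^T by rewrite -[LHS]trmxK hC trmx_mul trmxK.
have : Q *m Q^T *m row_mx A B = row_mx A B.
  by rewrite h -mulmxA [Q^T *m _]mulmxA QQ mul1mx.
by rewrite mul_mx_row => /eq_row_mx.
Qed.

(** The augmented bases contain the column and row spans of the current iterate,
    so projecting leaves [U] alone; they contain those of the truncated
    right-hand side too, so projecting [F] costs at most the truncation error
    [eps1].  The second truncation costs [eps2]. *)
Lemma SAT_step_error m n (F : 'M[R]_(m, n) -> 'M[R]_(m, n)) (tau eps1 eps2 : R)
    (u u' : factored R m n) : 0 <= tau -> SAT_step F tau eps1 eps2 u u' ->
  frob (fval u' - (fval u + tau *: F (fval u))) <= tau * eps1 + eps2.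
Proof.
move=> tau0 [b [rx [rv [X [V [[_ _ hb _] oX oV [_ _ hu' _]]]]]]].
have [XX _] := oX; have [VV _] := oV.
have [XA XB] := is_ortho_proj oX; have [VA VB] := is_ortho_proj oV.
set S1 := (X in frob (_ - X *m _) <= _) in hu'; set F0 := F (fval u) in hb S1 hu' *.
have proj (w : factored R m n) : X *m X^T *m fX w = fX w ->
    V *m V^T *m fV w = fV w -> X *m X^T *m fval w *m (V *m V^T) = fval w.
  move=> Xw Vw; rewrite /fval !mulmxA Xw -!mulmxA; congr (_ *m (_ *m _)).
  by rewrite -[RHS]trmxK trmxK -{2}Vw !trmx_mul !trmxK !mulmxA.
have E1 : S1 *m V^T = fval u + tau *: (X *m X^T *m F0 *m (V *m V^T)).
  rewrite /S1 mulmxDr mulmxDl; congr (_ + _).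
    rewrite trmx_mul trmxK -[RHS]proj// /fval !mulmxA //.
  by rewrite -!scalemxAr -scalemxAl !mulmxA.
have -> : fval u' - (fval u + tau *: F0) =
    (fval u' - S1 *m V^T) + tau *: (X *m X^T *m F0 *m (V *m V^T) - F0).
  by rewrite E1 scalerBr !opprD !addrA subrK.
apply: le_trans (frobD _ _) _; rewrite addrC lerD// frobZ// ler_wpM2l//.
have -> : X *m X^T *m F0 *m (V *m V^T) - F0 =
    X *m X^T *m (F0 - fval b) *m (V *m V^T) - (F0 - fval b).
  by rewrite mulmxBr mulmxBl (proj b)// opprB addrA subrK.
by apply: le_trans (frob_compression _ XX VV) _; rewrite -frobN opprB.
Qed.

End frobenius.

(** * Linear change of variables *)

Section line.
Context (R : realType).
Local Notation mu := (@lebesgue_measure R).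
Local Notation R' := (measurableTypeR R).

Lemma measurable_affine1 (p b : R) :
  measurable_fun [set: R'] (fun a : R' => a * p + b : R').
Proof. by apply: measurable_funD => //; exact: measurable_funM. Qed.

Lemma lebesgue_affine_pos (p b : R) (S : set R') : 0 < p -> measurable S ->
  (p%:E * mu [set a : R' | S (a * p + b)%R] = mu S)%E.
Proof.
move=> p0 mS.
pose m := mscale (NngNum (ltW p0))
  (measure_function_pushforward__canonical__measure_function_Measure mu
     (measurable_affine1 p b)).
apply/esym; apply: (@lebesgue_measure_unique R m) => // _ [[x y] _ <-] /=.
transitivity (p%:E * mu (`](x - b) / p, (y - b) / p]%classic)%R)%E; last first.
  apply: (congr1 (fun z => p%:E * mu z)%E); apply/seteqP; split => a /=;
  by rewrite !in_itv /= ltr_pdivrMr// ler_pdivlMr// ltrBlDr lerBrDr.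
rewrite !lebesgue_measure_itv/= !lte_fin ltr_pM2r ?invr_gt0// ltrD2r.
case: ifP => _; last by rewrite mule0.
by rewrite -!EFinB -EFinM; congr EFin; field; rewrite gt_eqF.
Qed.

Lemma lebesgue_affine (p b : R) (S : set R') : p != 0 -> measurable S ->
  (`|p|%:E * mu [set a : R' | S (a * p + b)%R] = mu S)%E.
Proof.
move=> p0 mS; have [ppos|pneg|peq] := ltrgtP p 0; last 1 first.
- by rewrite peq eqxx in p0.
- rewrite ltr0_norm// -(@lebesgue_affine_pos (- p) b S) ?oppr_gt0//.
  congr (_ * _)%E; rewrite -lebesgue_measureN.
    by congr mu; apply/seteqP; split => a /=; rewrite mulrN mulNr.
  by rewrite -[X in measurable X]setTI; exact: measurable_affine1.
- by rewrite gtr0_norm// lebesgue_affine_pos.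
Qed.

Lemma ge0_integral_affine (p b : R) (f : R' -> \bar R) : p != 0 ->
  measurable_fun [set: R'] f -> (forall x, 0 <= f x)%E ->
  (`|p|%:E * \int[mu]_a f (a * p + b)%R = \int[mu]_a f a)%E.
Proof.
move=> p0 mf f0.
rewrite -(@ge0_integral_pushforward _ _ _ _ _ _ (measurable_affine1 p b) mu setT f)//.
rewrite -(@ge0_integral_mscale _ _ _ _ _ measurableT (NngNum (normr_ge0 p)) f)//.
  exact: measurable_affine1.
by move=> mh; apply: eq_measure_integral => A mA _; exact: lebesgue_affine.
Qed.

End line.

Section leb_recursion.
Context (R : realType).
Local Notation mu := (@lebesgue_measure R).
Local Notation R' := (measurableTypeR R).

Lemma rv_consE n (a : R) (y : 'rV[R]_n) :
  rv_cons (a, y) = row_mx (a%:M : 'M[R]_1) y.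
Proof.
apply/rowP => i; rewrite [LHS]mxE; case: unliftP => [j|] -> /=.
  have -> : lift ord0 j = rshift 1 j by apply/val_inj.
  by rewrite (row_mxEr (a%:M : 'M[R]_1)).
have -> : ord0 = lshift n (ord0 : 'I_1) by apply/val_inj.
by rewrite (row_mxEl (a%:M : 'M[R]_1)) mxE.
Qed.

Lemma measurable_rv_consl n (a : R) :
  measurable_fun [set: 'rV[R]_n] (fun y => rv_cons (a, y)).
Proof.
apply: (measurableT_comp (@measurable_rv_cons R n)).
by apply/measurable_fun_pairP; split; [exact: measurable_cst|exact: measurable_id].
Qed.

Lemma measurable_rv_consr n (y : 'rV[R]_n) :
  measurable_fun [set: R'] (fun a : R' => rv_cons (a, y)).
Proof.
apply: (measurableT_comp (@measurable_rv_cons R n)).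
by apply/measurable_fun_pairP; split; [exact: measurable_id|exact: measurable_cst].
Qed.

Lemma measurable_preimageT d d' (S : measurableType d) (T : measurableType d')
  (f : S -> T) (A : set T) : measurable_fun [set: S] f -> measurable A ->
  measurable (f @^-1` A).
Proof. by move=> mf mA; rewrite -[X in measurable X]setTI; exact: mf. Qed.

Lemma leb_succ1 n (S : set 'rV[R]_n.+1) :
  leb R n.+1 S =
  (\int[mu]_a leb R n [set y | S (rv_cons (a, y))])%E.
Proof.
apply: eq_integral => a _ /=; congr (leb R n _).
by apply/seteqP; split=> y; rewrite /xsection /= inE.
Qed.

Lemma leb_succ2 n (S : set 'rV[R]_n.+1) : measurable S ->
  leb R n.+1 S =
  (\int[leb R n]_y mu [set a : R' | S (rv_cons (a, y))])%E.
Proof.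
move=> mS.
transitivity ((mu \x^ leb R n)%E (@rv_cons R n @^-1` S)).
  apply: product_measure_unique => [A B mA mB|].
    exact: product_measure2E.
  exact: measurable_preimageT (@measurable_rv_cons R n) mS.
apply: eq_integral => y _ /=; congr (mu _).
by apply/seteqP; split=> a; rewrite /ysection /= inE.
Qed.

Lemma measurable_leb_section n (S : set 'rV[R]_n.+1) : measurable S ->
  measurable_fun [set: R'] (fun a : R' => leb R n [set y | S (rv_cons (a, y))]).
Proof.
move=> mS; have mS' := measurable_preimageT (@measurable_rv_cons R n) mS.
apply: eq_measurable_fun (measurable_fun_xsection (leb R n) mS') => a _ /=.
by congr (leb R n _); apply/seteqP; split=> y; rewrite /xsection /= inE.
Qed.

Lemma measurable_fun_sum_rv d (T : measurableType d) D m (c : 'I_m -> R) (f : 'I_m -> T -> R) :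
  (forall i, measurable_fun D (f i)) ->
  measurable_fun D (fun x => \sum_i f i x * c i).
Proof.
move=> mf; apply: measurable_sum => i.
by apply: measurable_funM => //; exact: measurable_cst.
Qed.

Lemma measurable_mulmx n m (M : 'M[R]_(n, m)) (b : 'rV[R]_m) :
  measurable_fun [set: 'rV[R]_n] (fun x : 'rV[R]_n => x *m M + b).
Proof.
apply: measurable_fun_coorP => i; under eq_fun do rewrite !mxE.
apply: measurable_funD; last exact: measurable_cst.
by apply: measurable_fun_sum_rv => j; exact: measurable_coor.
Qed.

End leb_recursion.

Section leb_affine.
Context (R : realType).
Local Notation mu := (@lebesgue_measure R).
Local Notation R' := (measurableTypeR R).

(** Shearing along the first coordinate translates each line parallel to it. *)
Lemma leb_shear n (r : 'cV[R]_n) (S : set 'rV[R]_n.+1) : measurable S ->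
  leb R n.+1 [set x | S (x *m block_mx (1%:M : 'M[R]_1) 0 r 1%:M)] = leb R n.+1 S.
Proof.
move=> mS; set M := block_mx _ _ _ _.
have mSM : measurable [set x | S (x *m M)].
  have := measurable_preimageT (measurable_mulmx M 0) mS.
  by congr measurable; apply/seteqP; split => x /=; rewrite addr0.
rewrite leb_succ2// leb_succ2//; apply: eq_integral => y _.
have mSy : measurable [set a : R' | S (rv_cons (a, y))].
  exact: measurable_preimageT (@measurable_rv_consr R n y) mS.
rewrite -(lebesgue_affine ((y *m r) ord0 ord0) (oner_neq0 R) mSy) normr1 mul1e.
congr (mu _); apply/seteqP; split => a /=.
  rewrite !rv_consE /M mul_row_block !mulmx1 mulmx0 add0r mulr1.
  by rewrite {1}[y *m r]mx11_scalar -raddfD.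
rewrite !rv_consE /M mul_row_block !mulmx1 mulmx0 add0r mulr1.
by rewrite {2}[y *m r]mx11_scalar -raddfD.
Qed.

(** On each slice of constant first coordinate the map is affine with linear part
    [B], and the slices themselves are moved by an affine map of slope [p]. *)
Lemma leb_upper n (p : R) (q : 'rV[R]_n) (B : 'M[R]_n) (b : 'rV[R]_n.+1)
    (S : set 'rV[R]_n.+1) :
  (forall c S', measurable S' ->
    (`|\det B|%:E * leb R n [set x : 'rV[R]_n | S' (x *m B + c)%R] = leb R n S')%E) ->
  p != 0 -> measurable S ->
  (`|p * \det B|%:E *
     leb R n.+1 [set x : 'rV[R]_n.+1 | S (x *m block_mx (p%:M : 'M[R]_1) q 0 B + b)%R]
   = leb R n.+1 S)%E.
Proof.
move=> IH p0 mS; set M := block_mx _ _ _ _.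
rewrite !leb_succ1 normrM EFinM -muleA.
have mf := measurable_leb_section mS.
rewrite -(ge0_integral_affine (b ord0 ord0) p0 mf); last by move=> x; exact: measure_ge0.
congr (_ * _)%E.
have mSM := measurable_preimageT (measurable_mulmx M b) mS.
rewrite -ge0_integralZl//; last exact: measurable_leb_section mSM.
apply: eq_integral => a _ /=.
have mSa : measurable [set y | S (rv_cons (a * p + b ord0 ord0, y))].
  exact: measurable_preimageT (@measurable_rv_consl R n _) mS.
rewrite -(IH (a *: q + rsubmx (b : 'rV[R]_(1 + n))) _ mSa); congr (_ * leb R n _)%E.
have e y : rv_cons (a, y) *m M + b =
    rv_cons (a * p + b ord0 ord0, y *m B + (a *: q + rsubmx (b : 'rV[R]_(1 + n)))).
  rewrite !rv_consE /M (mul_row_block (a%:M : 'M[R]_1) y (p%:M : 'M[R]_1) q 0 B).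
  rewrite -scalar_mxM mulmx0 addr0 mul_scalar_mx.
  rewrite -[b in LHS](@hsubmxK _ _ 1 n) add_row_mx (addrC (a *: q)) addrA; congr row_mx.
  rewrite raddfD [lsubmx _]mx11_scalar; congr (_ + _%:M); rewrite mxE; congr (b _ _).
  exact/val_inj.
by apply/seteqP; split => y /=; rewrite e.
Qed.

(** Induction on the dimension.  A shear of the last coordinates into the first
    one makes the upper left entry nonzero, and the matrix then splits into a
    shear and a block upper triangular factor; the effect of each factor on the
    measure is computed by iterated integration. *)
Theorem leb_affine n (M : 'M[R]_n) (b : 'rV[R]_n) (S : set 'rV[R]_n) :
  M \in unitmx -> measurable S ->
  (`|\det M|%:E * leb R n [set x : 'rV[R]_n | S (x *m M + b)%R] = leb R n S)%E.
Proof.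
elim: n M b S => [|n IH] M b S uM mS.
  rewrite det_mx00 normr1 mul1e; congr (leb R 0 _).
  by apply/seteqP; split => x; rewrite /= [x *m M + b]thinmx0 [x]thinmx0.
pose M1 : 'M[R]_(1 + n) := M.
have [r pr] : exists r : 'cV[R]_n,
    (ulsubmx M1 + ursubmx M1 *m r) ord0 ord0 != 0.
  have [p0|] := eqVneq (ulsubmx M1) 0; last first.
    move=> p0; exists 0; rewrite mulmx0 addr0.
    apply: contra_neq p0 => p0; by rewrite [LHS]mx11_scalar p0 raddf0.
  exists (ursubmx M1)^T; rewrite p0 add0r.
  have [q0|q0] := eqVneq (ursubmx M1) 0.
    have : row_free M1 by rewrite row_free_unit.
    move=> /row_free_inj/(_ (row_mx (1%:M : 'M[R]_1) (0 : 'rV_n)) 0).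
    rewrite -[M1]submxK p0 q0 mul_row_block !mulmx0 !mul0mx !addr0 row_mx0.
    move=> /(_ erefl) /(congr1 (@lsubmx _ _ _ _)); rewrite row_mxKl => /matrixP/(_ ord0 ord0).
    by rewrite !mxE => /eqP; rewrite oner_eq0.
  apply: contraNN q0 => /eqP; rewrite mxE.
  under eq_bigr do rewrite [_^T _ _]mxE.
  move=> /eqP; rewrite psumr_eq0; last by move=> i _; rewrite -expr2 sqr_ge0.
  move=> /allP h; apply/eqP/rowP => j; rewrite [RHS]mxE.
  by have := h j (mem_index_enum _); rewrite mulf_eq0 orbb => /eqP.
pose sh (s : 'cV[R]_n) : 'M[R]_(1 + n) := block_mx 1%:M 0 s 1%:M.
have shK s : sh s *m sh (- s) = 1%:M.
  rewrite /sh mulmx_block !mulmx0 !mul0mx !mulmx1 !mul1mx !addr0 add0r.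
  by rewrite subrr -scalar_mx_block.
have dsh s : \det (sh s) = 1 by rewrite det_lblock !det1 mulr1.
pose M2 := M1 *m sh r.
set p := (X in X != 0) in pr.
have pE : ulsubmx M2 = p%:M.
  rewrite /M2 -[M1]submxK mulmx_block block_mxKul !mulmx1.
  by rewrite [LHS]mx11_scalar.
pose c := p^-1 *: dlsubmx M2; pose q := ursubmx M2.
pose B := drsubmx M2 - c *m q.
have M2E : M2 = sh c *m block_mx p%:M q 0 B.
  rewrite /sh mulmx_block !mul1mx !mul0mx !addr0 /B [_ + (_ - _)]addrC subrK.
  rewrite mul_mx_scalar scalerA divff// scale1r -pE.
  by rewrite submxK.
have M1E : M1 = sh c *m block_mx p%:M q 0 B *m sh (- r).
  by rewrite -M2E /M2 -mulmxA shK mulmx1.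
have dM : \det M1 = p * \det B.
  by rewrite M1E !det_mulmx !dsh mul1r mulr1 det_ublock det_scalar1.
have uB : B \in unitmx.
  move: uM; rewrite !unitmxE -/M1 dM unitrM => /andP[_] //.
pose S1 := [set x : 'rV[R]_n.+1 | S (x *m sh (- r))].
pose b1 : 'rV[R]_(1 + n) := b *m sh r.
pose S2 := [set x : 'rV[R]_n.+1 | S1 (x *m block_mx p%:M q 0 B + b1)].
have mS1 : measurable S1.
  have := measurable_preimageT (measurable_mulmx (sh (- r)) 0) mS.
  by congr measurable; apply/seteqP; split => x /=; rewrite addr0.
have mS2 : measurable S2 := measurable_preimageT (measurable_mulmx _ b1) mS1.
have -> : \det M = p * \det B := dM.
rewrite -[RHS](leb_shear (- r) mS) -/(sh _) -/S1.
rewrite -[RHS](@leb_upper n p q B b1)// => [|? ? ?]; last exact: IH.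
congr (_ * _)%E; rewrite -/S2 -[RHS](leb_shear c)//; congr (leb R n.+1 _).
have e x : (x *m sh c *m block_mx p%:M q 0 B + b1) *m sh (- r) = x *m M + b.
  rewrite mulmxDl /b1 -(mulmxA b) shK mulmx1 -!mulmxA.
  by rewrite (mulmxA (sh c)) -M1E.
by apply/seteqP; split => x; rewrite /S2 /S1 /= -/(sh c) e.
Qed.

End leb_affine.

(** * Null sets of polyhedra *)

Section topology_rv.
Context (R : realType).

Lemma near_finType (T : Type) (I : finType) (F : set_system T) (P : I -> T -> Prop) :
  Filter F -> (forall i, \forall x \near F, P i x) ->
  \forall x \near F, forall i, P i x.
Proof.
move=> FF FP.
suff : \forall x \near F, forall i, i \in enum I -> P i x.
  by apply: filterS => x Px i; apply: Px; rewrite mem_enum.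
elim: (enum I) => [|i s IHs]; first by apply: nearW.
apply: filterS2 (FP i) IHs => x Pix Psx j.
by rewrite inE => /predU1P[->//|]; exact: Psx.
Qed.

Lemma near_coorP n (x : 'rV[R]_n) (P : 'rV[R]_n -> Prop) :
  (\forall y \near x, P y) <->
  exists2 e : R, 0 < e & forall y : 'rV[R]_n, (forall i, `|y ord0 i - x ord0 i| < e) -> P y.
Proof.
split.
  move=> /nbhs_ballP[e e0 xe]; exists e => // y yx; apply: xe.
  by split=> // i j; rewrite /ball/= ord1 distrC.
move=> [e e0 xe]; apply/nbhs_ballP; exists e => // y [_ yx].
by apply: xe => i; rewrite distrC; exact: yx.
Qed.

Lemma open_coorP n (A : set 'rV[R]_n) (x : 'rV[R]_n) : open A -> A x ->
  exists2 e : R, 0 < e & forall y : 'rV[R]_n, (forall i, `|y ord0 i - x ord0 i| < e) -> A y.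
Proof. by move=> oA Ax; apply/near_coorP; exact: open_nbhs_nbhs. Qed.

Lemma continuous_coorP (T : topologicalType) n (f : T -> 'rV[R]_n) :
  (forall i, continuous (fun x => f x ord0 i)) -> continuous f.
Proof.
move=> cf x; apply/cvgrPdist_lt => e e0.
have : \forall y \near x, forall i, `|f x ord0 i - f y ord0 i| < e.
  by apply: near_finType => i; have /cvgrPdist_lt := cf i x; exact.
apply: filterS => y fy; suff : ball (f x) e (f y) by rewrite mx_norm_ball.
by split => // i j; rewrite ord1; exact: fy.
Qed.

Lemma continuous_bigsum (T : topologicalType) (I : finType) (f : I -> T -> R) :
  (forall i, continuous (f i)) -> continuous (fun x => \sum_i f i x).
Proof.
move=> cf x.
suff h (s : seq I) : \sum_(i <- s) f i y @[y --> x] --> \sum_(i <- s) f i x by exact: h.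
elim: s => [|i s IHs].
  by rewrite big_nil; under [X in X @ _]eq_fun do rewrite big_nil; exact: cvg_cst.
rewrite big_cons; under [X in X @ _]eq_fun do rewrite big_cons.
by apply: cvgD; [exact: cf|].
Qed.

Lemma continuous_linear n (c : 'I_n -> R) :
  continuous (fun x : 'rV[R]_n => \sum_j x ord0 j * c j).
Proof.
apply: continuous_bigsum => j y.
exact: (cvgM (@coord_continuous R 1 n ord0 j y) (cvg_cst _)).
Qed.

Lemma continuous_mulmxD n m (M : 'M[R]_(n, m)) (b : 'rV[R]_m) :
  continuous (fun x : 'rV[R]_n => x *m M + b).
Proof.
apply: continuous_coorP => i.
under eq_fun do rewrite !mxE.
by move=> x; exact: (cvgD (@continuous_linear _ (M^~ i) x) (cvg_cst _)).
Qed.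

Lemma dotE n (x y : 'rV[R]_n) : dot x y = \sum_j y ord0 j * x ord0 j.
Proof. by rewrite /dot mxE; apply: eq_bigr => j _; rewrite mxE mulrC. Qed.

Lemma continuous_dot n (m : 'rV[R]_n) : continuous (dot m).
Proof.
rewrite (_ : dot m = fun x => \sum_j x ord0 j * m ord0 j).
  exact: continuous_linear.
by apply/funext => x; rewrite dotE.
Qed.

Lemma measurable_dot n (m : 'rV[R]_n) : measurable_fun [set: 'rV[R]_n] (dot m).
Proof.
rewrite (_ : dot m = fun x => \sum_j x ord0 j * m ord0 j).
  by apply: measurable_fun_sum_rv => j; exact: measurable_coor.
by apply/funext => x; rewrite dotE.
Qed.

(** The measurable sets are generated by the coordinates, so an open set has to be
    written as a countable union of cubes with rational data. *)
Lemma open_measurable_rv n (A : set 'rV[R]_n) : open A -> measurable A.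
Proof.
move=> oA.
pose cube (c : 'rV[rat]_n) (k : nat) : set 'rV[R]_n :=
  [set x | forall i, `|x ord0 i - ratr (c ord0 i)| < k.+1%:R^-1].
have mcube c k : measurable (cube c k).
  rewrite (_ : cube c k = \bigcap_(i : 'I_n)
      ((fun x : 'rV[R]_n => x ord0 i) @^-1`
       ball (ratr (c ord0 i) : R) k.+1%:R^-1)).
    apply: fin_bigcap_measurable; first exact: finite_finset.
    move=> i _; apply: measurable_preimageT (measurable_coor i) _.
    exact: measurable_ball.
  apply/seteqP; split => x /= h i; [move=> _|].
    by rewrite /ball /= distrC; exact: h.
  by rewrite distrC; exact: (h i I).
have -> : A = \bigcup_(ck : 'rV[rat]_n * nat)
    (if `[< cube ck.1 ck.2 `<=` A >] then cube ck.1 ck.2 else set0).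
  apply/seteqP; split => x; last first.
    by move=> [[c k] _] /=; case: ifPn => // /asboolP; exact.
  move=> Ax; have [e e0 xe] := open_coorP oA Ax.
  have [k ke] : exists k : nat, k.+1%:R^-1 < e / 2 :> R.
    have e2 : 0 < e / 2 by rewrite divr_gt0.
    by have [k _ kP] := near_infty_natSinv_lt (PosNum e2); exists k; exact: kP (leqnn k).
  have cP i : exists q : rat, `|x ord0 i - ratr q| < k.+1%:R^-1 :> R.
    have : x ord0 i - k.+1%:R^-1 < x ord0 i + k.+1%:R^-1.
      by rewrite ltrBlDr -addrA ltrDl addr_gt0// invr_gt0.
    move=> /rat_in_itvoo[q]; rewrite in_itv /= => /andP[q1 q2]; exists q.
    move: q1 q2; set w := _^-1 => q1 q2.
    by rewrite ltr_norml; apply/andP; split; lra.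
  have [q qP] := choice cP.
  exists (\row_i q i, k) => //=; case: asboolP => [_ i|]; first by rewrite mxE.
  move=> nA; exfalso; apply: nA => y cy; apply: xe => i.
  have := cy i; have := qP i; rewrite mxE.
  move: ke; set w := _^-1 => ke.
  rewrite !ltr_norml => /andP[? ?] /andP[? ?]; apply/andP; split; lra.
apply: countable_bigcupT_measurable; first exact: countableP.
by move=> ck; case: ifP.
Qed.

Lemma coor_le_norm n (x : 'rV[R]_n) i : `|x ord0 i| <= `|x|.
Proof.
have -> : `|x| = mx_norm x by [].
by rewrite mx_normrE; apply: (le_bigmax _ (fun ij => `|x ij.1 ij.2|) (ord0, i)).
Qed.

Lemma leb_bounded n (A : set 'rV[R]_n) : measurable A -> bounded_set A ->
  (leb R n A < +oo)%E.
Proof.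
move=> mA [M0 [_ AM]]; pose M := M0 + 1.
pose box m := [set x : 'rV[R]_m | forall i, `|x ord0 i| <= M].
have mbox m : measurable (box m).
  rewrite (_ : box m = \bigcap_(i : 'I_m)
      ((fun x : 'rV[R]_m => x ord0 i) @^-1` `[- M, M])).
    apply: fin_bigcap_measurable; first exact: finite_finset.
    move=> i _; apply: measurable_preimageT (measurable_coor i) _.
    exact: measurable_itv.
  apply/seteqP; split => x /= h i; [move=> _|].
    by change (x ord0 i \in `[- M, M]); rewrite in_itv /= -ler_norml; exact: h.
  have : x ord0 i \in `[- M, M] := h i I.
  by rewrite in_itv /= -ler_norml.
apply: (@le_lt_trans _ _ (leb R n (box n))).
  apply: le_measure; [by rewrite inE|by rewrite inE; exact: mbox|].
  move=> x Ax i; have := AM M; rewrite /M ltrDl => /(_ ltr01) /(_ x Ax).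
  exact: le_trans (coor_le_norm x i).
elim: n {A mA AM} => [|n IH].
  apply: le_lt_trans (_ : (1%:E < +oo)%E); last exact: ltry.
  by rewrite /= diracE lee_fin lern1 leq_b1.
rewrite (_ : leb R n.+1 (box n.+1) =
    (lebesgue_measure (`[- M, M]%classic)%R * leb R n (box n))%E).
  apply: lte_mul_pinfty => //; rewrite lebesgue_measure_itv /=.
  by case: ifP.
rewrite /= /rv_measure_succ /pushforward.
rewrite (_ : _ @^-1` _ = (`[- M, M]%classic : set (measurableTypeR R)) `*` box n).
  by rewrite product_measure1E; [| |exact: mbox].
apply/seteqP; split => -[a y] /=.
  move=> h; split => /=; first by
    rewrite in_itv/= -ler_norml; have := h ord0; rewrite mxE unlift_none.
  by move=> i; have := h (lift ord0 i); rewrite mxE liftK.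
move=> [/= ha hy] i; rewrite mxE; case: unliftP => [j _|_] /=; first exact: hy.
by rewrite ler_norml; move: ha; rewrite in_itv.
Qed.

End topology_rv.

Section null_boundaries.
Context (R : realType).

(** By induction on the dimension: if the first component of the normal vanishes,
    the hyperplane is a product with a hyperplane; otherwise it meets every line
    parallel to the first axis in one point. *)
Lemma hyperplane_null n (m : 'rV[R]_n) (c : R) : m != 0 ->
  (leb R n).-negligible [set x | dot m x = c].
Proof.
have mH k (m' : 'rV[R]_k) c' : measurable [set x | dot m' x = c'].
  exact: measurable_preimageT (measurable_dot m') (measurable_set1 c').
move=> m0; suff h : leb R n [set x | dot m x = c] = 0%E.
  by apply/negligibleP; [exact: mH|exact: h].
elim: n m c m0 => [|n IH] m c m0; first by rewrite thinmx0 eqxx in m0.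
pose m' : 'rV[R]_n := \row_i m ord0 (lift ord0 i).
have dotS (a : R) y : dot m (rv_cons (a, y)) = a * m ord0 ord0 + dot m' y.
  rewrite !dotE big_ord_recl; congr (_ * _ + _); first by rewrite mxE unlift_none.
  by apply: eq_bigr => i _; rewrite !mxE liftK.
have [m00|m00] := eqVneq (m ord0 ord0) 0; last first.
  rewrite leb_succ2; last exact: mH.
  apply: integral0_eq => y _ /=.
  rewrite (_ : [set a | _] = [set (c - dot m' y) / m ord0 ord0]).
    by rewrite lebesgue_measure_set1.
  apply/seteqP; split => a /=; rewrite dotS.
    by move=> <-; rewrite addrK mulfK.
  by move=> ->; rewrite divfK// subrK.
rewrite leb_succ1; apply: integral0_eq => a _ /=.
rewrite (_ : [set y | _] = [set y | dot m' y = c]).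
  apply: IH; apply: contra_neq m0 => m'0; apply/rowP => i; rewrite [RHS]mxE.
  have [j ->|->//] := unliftP ord0 i.
  by have := congr1 (fun v : 'rV_n => v ord0 j) m'0; rewrite !mxE.
by apply/seteqP; split => y /=; rewrite dotS m00 mulr0 add0r.
Qed.

Lemma negligible_finType d (T : measurableType d) (mu : {measure set T -> \bar R})
    (I : finType) (A : I -> set T) :
  (forall i, mu.-negligible (A i)) -> mu.-negligible (\bigcup_i A i).
Proof.
move=> nA.
suff : mu.-negligible [set x | exists2 i, i \in enum I & A i x].
  by apply: negligibleS => x [i _ Aix]; exists i => //; rewrite mem_enum.
elim: (enum I) => [|i s IHs].
  by apply: negligibleS (negligible_set0 mu) => x [].
apply: negligibleS (negligibleU (nA i) IHs) => x [j]; rewrite inE.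
by move=> /predU1P[-> ?|? ?]; [left|right; exists j].
Qed.

Definition seq_mx n (s : seq 'rV[R]_n) : 'M[R]_(size s, n) :=
  \matrix_(i < size s) s`_i.

Lemma conv_hullE n (s : seq 'rV[R]_n) : conv_hull s =
  [set w *m seq_mx s | w in
     [set w : 'rV[R]_(size s) | (forall i, 0 <= w ord0 i) /\ \sum_i w ord0 i = 1]].
Proof.
have mulE (w : 'rV[R]_(size s)) : w *m seq_mx s = \sum_i w ord0 i *: s`_i.
  by rewrite mulmx_sum_row; apply: eq_bigr => i _; rewrite rowK.
apply/seteqP; split => x /=.
  move=> [w [w0 w1 ->]]; exists (\row_i w i).
    split; first by move=> i; rewrite mxE.
    by rewrite -w1; apply: eq_bigr => i _; rewrite mxE.
  by rewrite mulE; apply: eq_bigr => i _; rewrite mxE.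
by move=> [w [w0 w1] <-]; exists (w ord0); rewrite mulE.
Qed.

Lemma closed_preimageT (T U : topologicalType) (f : T -> U) (D : set U) :
  continuous f -> closed D -> closed (f @^-1` D).
Proof. by move=> cf; apply: preimage_closed => x _; exact: cf. Qed.

Lemma compact_conv_hull n (s : seq 'rV[R]_n) : compact (conv_hull s).
Proof.
rewrite conv_hullE; apply: continuous_compact.
  apply: continuous_subspaceT.
  rewrite (_ : (fun w => _) = fun w : 'rV[R]_(size s) => w *m seq_mx s + 0).
    exact: continuous_mulmxD.
  by apply/funext => w; rewrite addr0.
have cbox : compact [set w : 'rV[R]_(size s) | forall i, w ord0 i \in `[0, 1]].
  exact: (@rV_compact R _ (fun=> `[0, 1]%classic) (fun=> @segment_compact R 0 1)).
set S := [set w | _].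
have SE : S = (\bigcap_(i : 'I_(size s))
      ((fun w : 'rV[R]_(size s) => w ord0 i) @^-1` [set x | 0 <= x]))
    `&` ((fun w : 'rV[R]_(size s) => \sum_i w ord0 i) @^-1` [set 1]).
  apply/seteqP; split => w /= [h1 h2]; split=> // i; [move=> _; exact: h1|exact: (h1 i I)].
apply: (subclosed_compact _ cbox).
  rewrite SE; apply: closedI.
    apply: closed_bigI => i _; apply: closed_preimageT; last exact: closed_ge.
    exact: coord_continuous.
  apply: closed_preimageT; last exact: closed_eq.
  by apply: continuous_bigsum => i; exact: coord_continuous.
move=> w [w0 w1] i; rewrite /= in_itv /= w0 /= -w1 (bigD1 i)//= lerDl.
exact: sumr_ge0.
Qed.

Lemma compact_polyhedron n (ss : seq (seq 'rV[R]_n)) : compact (polyhedron ss).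
Proof.
elim: ss => [|s ss IHs].
  rewrite (_ : polyhedron _ = set0); first exact: compact0.
  by apply/seteqP; split => // x [s].
rewrite (_ : polyhedron _ = conv_hull s `|` polyhedron ss).
  by apply: compactU => //; exact: compact_conv_hull.
apply/seteqP; split => x.
  by move=> [t /=]; rewrite inE => /predU1P[->|ts xt]; [left|right; exists t].
move=> [xs|[t /= ts xt]]; first by exists s => //=; rewrite inE eqxx.
by exists t => //=; rewrite inE ts orbT.
Qed.

End null_boundaries.

Section polytope_boundary.
Context (R : realType).

(** Lifting the points to height 1 turns affine into linear dependence: the rows
    of this matrix indexed by [J] span everything exactly when the corresponding
    points affinely span the space. *)
Definition lifted_mx n (s : seq 'rV[R]_n) (J : {set 'I_(size s)}) :
    'M[R]_(size s, n + 1) :=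
  diag_mx (\row_i (i \in J)%:R) *m row_mx (seq_mx s) (const_mx 1).

(** Every small displacement of a point can be absorbed by the weights of an affinely
    spanning set of points, and weights that are positive remain so. *)
Lemma lifted_full_interior n (s : seq 'rV[R]_n) (w : 'rV[R]_(size s)) :
  (forall i, 0 <= w ord0 i) -> \sum_i w ord0 i = 1 ->
  row_full (lifted_mx [set i | 0 < w ord0 i]%SET) ->
  interior (conv_hull s) (w *m seq_mx s).
Proof.
move=> w0 w1; set J := (X in lifted_mx X); set A := lifted_mx J => fA.
set x := w *m seq_mx s.
pose U := usubmx (pinvmx A).
pose del (y : 'rV[R]_n) := y *m U + (- (x *m U)).
have near_pos i : \forall y \near x, 0 <= w ord0 i + (i \in J)%:R * del y ord0 i.
  have [iJ|_] := boolP (i \in J); last by apply: (@filterE _ (nbhs x)) => y; rewrite mul0r addr0.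
  have wi : 0 < w ord0 i by move: iJ; rewrite inE.
  have : continuous (fun y => del y ord0 i).
    move=> y; apply: (@continuous_comp _ _ _ del (fun M => M ord0 i)).
      exact: continuous_mulmxD.
    exact: coord_continuous.
  move=> /(_ x)/cvgrPdist_lt/(_ _ wi); apply: filterS => y.
  rewrite /= {1}/del subrr mxE sub0r normrN mul1r ltr_norml => /andP[h _].
  by rewrite -lerBlDl sub0r ltW.
have : \forall y \near x, forall i, 0 <= w ord0 i + (i \in J)%:R * del y ord0 i.
  exact: (@near_finType _ _ (nbhs x) _ _ near_pos).
apply: filterS => y ypos; rewrite conv_hullE /=.
have dA : del y *m A = row_mx (y - x) 0.
  have -> : del y = row_mx (y - x) 0 *m pinvmx A.
    by rewrite -[pinvmx A]vsubmxK mul_row_col mul0mx addr0 mulmxBl.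
  by rewrite mulmxKpV// submx_full.
pose w' := w + del y *m diag_mx (\row_i (i \in J)%:R).
have : w' *m row_mx (seq_mx s) (const_mx 1 : 'cV[R]_(size s)) =
    row_mx x (w *m (const_mx 1 : 'cV[R]_(size s))) + row_mx (y - x) 0.
  by rewrite /w' (mulmxDl w) mul_mx_row -mulmxA -/(lifted_mx J) -/A dA.
rewrite add_row_mx addr0 [x + _]addrC subrK mul_mx_row => /eq_row_mx[w'y w'1].
exists w' => //; split.
  move=> i; move: (ypos i); rewrite /w'; move: (del y) => D.
  by rewrite mxE mul_mx_diag !mxE mulrC.
have massE (v : 'rV[R]_(size s)) :
    (v *m (const_mx 1 : 'cV[R]_(size s))) ord0 ord0 = \sum_i v ord0 i.
  by rewrite mxE; apply: eq_bigr => i _; rewrite mxE mulr1.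
by rewrite -massE w'1 massE.
Qed.

(** The points that carry positive weights at a boundary point do not span the space
    affinely.  They lie in a hyperplane, and so does the boundary point; finitely many
    hyperplanes arise in this way, one for each set of points. *)
Lemma conv_hull_boundary_null n (s : seq 'rV[R]_n) :
  (leb R n).-negligible (conv_hull s `\` interior (conv_hull s)).
Proof.
pose B (J : {set 'I_(size s)}) := [set x | ~ interior (conv_hull s) x /\
  exists w : 'rV[R]_(size s), [/\ forall i, 0 <= w ord0 i, \sum_i w ord0 i = 1,
    J = [set i | 0 < w ord0 i]%SET & x = w *m seq_mx s]].
suff nB J : (leb R n).-negligible (B J).
  apply: negligibleS (negligible_finType nB) => x [].
  rewrite conv_hullE => -[w [w0 w1] xE] nx.
  exists [set i | 0 < w ord0 i]%SET => //; split; first by rewrite conv_hullE.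
  by exists w.
have [fJ|] := boolP (row_full (lifted_mx J)).
  apply: negligibleS (negligible_set0 _) => x [nx [w [w0 w1 JE xE]]].
  by apply: nx; rewrite xE; apply: lifted_full_interior; rewrite // -JE.
rewrite -cokermx_eq0 => /matrix0Pn[i0 [j0 ij0]].
set v := col j0 (cokermx (lifted_mx J)).
have Av : lifted_mx J *m v = 0.
  by rewrite /v colE mulmxA mulmx_coker mul0mx.
have v0 : v != 0.
  apply: contra_neq ij0 => h.
  by have := congr1 (fun M : 'cV[R]_(n + 1) => M i0 ord0) h; rewrite !mxE.
pose m := (usubmx v)^T; pose c := - dsubmx v ord0 ord0.
have mJ i : i \in J -> dot m (s`_i) = c.
  move=> iJ.
  have : (row_mx (seq_mx s) (const_mx 1) *m v) i ord0 = 0.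
    have := congr1 (fun M : 'cV[R]_(size s) => M i ord0) Av.
    rewrite /lifted_mx -mulmxA mul_diag_mx.
    by move: (row_mx _ _ *m v) => Bv; rewrite !mxE iJ mul1r.
  rewrite -[v]vsubmxK mul_row_col mxE => /eqP; rewrite addr_eq0 => /eqP.
  rewrite [LHS]mxE [in RHS]mxE big_ord1 [const_mx _ _ _]mxE mul1r /c => <-.
  by rewrite dotE; apply: eq_bigr => j _; rewrite [in LHS]mxE [in RHS]mxE.
have [J0|[i iJ]] := set_0Vmem J.
  apply: negligibleS (negligible_set0 _) => x [nx [w [w0 w1 JE xE]]].
  have : \sum_i w ord0 i = 0.
    apply: big1 => i _; apply/eqP; rewrite eq_le w0 andbT leNgt.
    by have : i \notin J by [rewrite J0 inE]; rewrite JE inE.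
  by move=> /eqP; rewrite w1 oner_eq0.
have m0 : m != 0.
  apply: contra_neq v0 => m0; rewrite -[v]vsubmxK -[usubmx v]trmxK -/m m0 trmx0.
  have := mJ _ iJ; rewrite m0 /dot mul0mx mxE /c => /esym/eqP.
  rewrite oppr_eq0 => /eqP d0.
  by rewrite [dsubmx v]mx11_scalar d0 raddf0 col_mx0.
apply: negligibleS (hyperplane_null c m0) => x [_ [w [w0 w1 JE ->]]] /=.
rewrite mulmx_sum_row.
have -> : dot m (\sum_i w 0 i *: row i (seq_mx s)) = \sum_i w ord0 i * dot m (s`_i).
  rewrite /dot raddf_sum /= mulmx_sumr summxE; apply: eq_bigr => j _.
  by rewrite rowK linearZ /= -scalemxAr mxE.
rewrite -[RHS]mul1r -w1 mulr_suml; apply: eq_bigr => j _.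
have [jJ|] := boolP (j \in J); first by rewrite mJ.
rewrite JE inE -leNgt => wj.
by have -> : w ord0 j = 0; [apply/eqP; rewrite eq_le wj w0|rewrite !mul0r].
Qed.

Lemma open_polytope_open n (P : set 'rV[R]_n) : open_polytope P -> open P.
Proof. by move=> [_ [ss ->]]; exact: open_interior. Qed.

Lemma open_polytope_measurable n (P : set 'rV[R]_n) : open_polytope P -> measurable P.
Proof. by move=> /open_polytope_open; exact: open_measurable_rv. Qed.

Lemma open_polytope_bounded n (P : set 'rV[R]_n) : open_polytope P -> bounded_set P.
Proof.
move=> [_ [ss ->]].
have [M0 [M0r AM]] := compact_bounded (@compact_polyhedron R n ss).
by exists M0; split => // M MM x Px; apply: AM => //; exact: interior_subset.
Qed.

Lemma open_polytope_leb_fin n (P : set 'rV[R]_n) : open_polytope P ->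
  (leb R n P < +oo)%E.
Proof.
by move=> pP; apply: leb_bounded; [exact: open_polytope_measurable|exact: open_polytope_bounded].
Qed.

Lemma open_polytope_boundary_null n (P : set 'rV[R]_n) : open_polytope P ->
  (leb R n).-negligible (closure P `\` P).
Proof.
move=> [_ [ss ->]].
pose B (i : 'I_(size ss)) :=
  conv_hull (nth [::] ss i) `\` interior (conv_hull (nth [::] ss i)).
have nB i : (leb R n).-negligible (B i) by exact: conv_hull_boundary_null.
apply: negligibleS (negligible_finType nB) => x [xc xi].
have : closure (polyhedron ss) x by apply: closureS xc; exact: interior_subset.
have /closure_id <- := compact_closed (@norm_hausdorff _ _) (@compact_polyhedron R n ss).
move=> [s /= sss xs].
have sss' := sss; rewrite -index_mem in sss'.
exists (Ordinal sss') => //; rewrite /B /= nth_index//; split => // xs'; apply: xi.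
by apply: filterS xs' => y ys; exists s.
Qed.

End polytope_boundary.

(** * The faces of a cell balance *)

Section crossing_count.
Context (R : realType).

Lemma locally_constant (f : R -> R) (a b : R) :
  (forall x, exists2 e : R, 0 < e & forall t, `|t - x| < e -> f t = f x) ->
  f a = f b.
Proof.
move=> lf; apply: is_derive_0_is_cst => x.
apply: (@near_eq_is_derive _ _ _ (cst (f x))).
have [e e0 fe] := lf x; apply/nbhs_ballP; exists e => // t.
by rewrite /ball /= distrC => /fe ->.
Qed.

Lemma exists_common_radius (I : finType) (P : I -> R -> Prop) (x : R) :
  (forall i, exists2 e : R, 0 < e & forall t, `|t - x| < e -> P i t) ->
  exists2 e : R, 0 < e & forall t, `|t - x| < e -> forall i, P i t.
Proof.
move=> hP; have : \forall t \near x, forall i, P i t.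
  apply: (@near_finType _ _ (nbhs x)) => i; have [e e0 Pe] := hP i.
  by apply/nbhs_ballP; exists e => // t; rewrite /ball /= distrC => /Pe.
move=> /nbhs_ballP[e e0 Pe]; exists e => // t te; apply: Pe.
by rewrite /ball /= distrC.
Qed.

(** Along a line, a bounded set is entered as often as it is left.  The function
    [Psi] adds to the indicator of the set the signed number of crossings already
    passed; it is locally constant, hence takes the same value at both ends of
    the line, where the indicator vanishes. *)
Lemma crossing_count (I : finType) (Q : pred I) (chi : R -> Prop) (s : I -> R)
    (sg : I -> R) (M : R) :
  (forall i j, Q i -> Q j -> s i = s j -> i = j) ->
  (forall i, Q i -> [/\ sg i = 1 \/ sg i = -1, ~ chi (s i) &
    exists2 e : R, 0 < e & forall t, 0 < t < e ->
      chi (s i - sg i * t) /\ ~ chi (s i + sg i * t)]) ->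
  (forall x, (forall i, Q i -> s i != x) ->
    exists2 e : R, 0 < e & forall t, `|t - x| < e -> (chi t <-> chi x)) ->
  (forall x, M < `|x| -> ~ chi x) ->
  \sum_(i | Q i) sg i = 0.
Proof.
move=> sinj scross sconst chiM.
(* the last summand makes the value at a crossing agree with the limit from the left:
   the crossing itself is outside of the set *)
pose g i t : R := sg i * (s i < t)%R%:R + ((s i == t) && (sg i == 1%R))%:R.
pose Psi t : R := (`[< chi t >])%:R + \sum_(i | Q i) g i t.
have gconst i x : s i != x ->
    exists2 e : R, 0 < e & forall t, `|t - x| < e -> g i t = g i x.
  move=> six; exists `|s i - x|; first by rewrite normr_gt0 subr_eq0.
  move=> t tx; rewrite /g (negbTE six).
  have -> : (s i == t) = false.
    by apply/negbTE; apply: contraTneq tx => ->; rewrite ltxx.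
  congr (_ * _%:R + _); move: six tx; rewrite neq_lt => /orP[six|six].
    have -> : `|s i - x| = x - s i by rewrite distrC gtr0_norm// subr_gt0.
    rewrite ltr_norml six => /andP[h _].
    by have -> : s i < t by lra.
  have -> : `|s i - x| = s i - x by rewrite gtr0_norm// subr_gt0.
  rewrite ltr_norml (ltNge (s i) x) (ltW six) => /andP[_ h].
  by have -> : (s i < t) = false by apply/negbTE; rewrite -leNgt; lra.
have Psi_const x : exists2 e : R, 0 < e & forall t, `|t - x| < e -> Psi t = Psi x.
  have [/existsP[i0 /andP[Qi0 /eqP si0]]|] := boolP [exists i, Q i && (s i == x)].
    have [sg0 nchi [e0 e00 he0]] := scross i0 Qi0.
    have [e1 e10 he1] : exists2 e : R, 0 < e & forall t, `|t - x| < e ->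
        forall i, i != i0 -> Q i -> g i t = g i x.
      apply: exists_common_radius => i.
      have [ii0|ii0] := eqVneq i i0; first by exists 1.
      have [Qi|nQi] := boolP (Q i); last by exists 1.
      have [|e e0' he] := gconst i x.
        by apply: contra_neq ii0 => six; apply: sinj => //; rewrite six si0.
      by exists e => // t /he.
    exists (Num.min e0 e1); first by rewrite lt_min e00.
    move=> t; rewrite lt_min => /andP[te0 te1].
    rewrite /Psi !(bigD1 i0 Qi0)/= !addrA; congr (_ + _); last first.
      by apply: eq_bigr => i /andP[Qi ii0]; apply: he1.
    have nx : ~ chi x by rewrite -si0.
    rewrite (asboolF nx) /g si0 ltxx eqxx mulr0 !add0r /=.
    have m11 : (-1 == 1 :> R) = false by apply/negbTE; rewrite lt_eqF// ltrN10.
    have [tx|tx|tx] := ltrgtP x t.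
    - have d0 : 0 < t - x < e0.
        by rewrite subr_gt0 tx /=; move: te0; rewrite gtr0_norm ?subr_gt0.
      have xt : x + (t - x) = t by rewrite addrC subrK.
      have [] := he0 _ d0; rewrite si0; case: sg0 => ->.
        by rewrite mul1r xt => _ h; rewrite (asboolF h) eqxx /=; lra.
      rewrite mulN1r opprK xt => h _.
      by rewrite (asboolT h) m11 /=; lra.
    - have d0 : 0 < x - t < e0.
        by rewrite subr_gt0 tx /=; move: te0; rewrite ltr0_norm ?subr_lt0// opprB.
      have [] := he0 _ d0; rewrite si0; case: sg0 => ->.
        by rewrite mul1r subKr => h _; rewrite (asboolT h) eqxx /=; lra.
      rewrite mulN1r subKr => _ h.
      by rewrite (asboolF h) m11 /=; lra.
    - by rewrite -tx (asboolF nx) mulr0 !add0r.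
  rewrite negb_exists => /forallP nh.
  have nhit i : Q i -> s i != x by move=> Qi; have := nh i; rewrite Qi.
  have [e0 e00 he0] := sconst x nhit.
  have [e1 e10 he1] : exists2 e : R, 0 < e & forall t, `|t - x| < e ->
      forall i, Q i -> g i t = g i x.
    apply: exists_common_radius => i.
    have [Qi|nQi] := boolP (Q i); last by exists 1.
    by have [e e0' he] := gconst i x (nhit i Qi); exists e => // t /he.
  exists (Num.min e0 e1); first by rewrite lt_min e00.
  move=> t; rewrite lt_min => /andP[te0 te1].
  rewrite /Psi; congr (_%:R + _); last by apply: eq_bigr => i Qi; exact: he1.
  by congr nat_of_bool; apply/asboolP/asboolP; have [] := he0 t te0.
pose B := 1 + `|M| + \sum_i `|s i|.
have sum0 : 0 <= \sum_i `|s i| by exact: sumr_ge0.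
have [M0 M1] : 0 <= `|M| /\ M <= `|M| by rewrite normr_ge0 ler_norm.
have sB i : - B < s i < B.
  rewrite -ltr_norml; have : `|s i| <= \sum_j `|s j|.
    by rewrite (bigD1 i)//= lerDl sumr_ge0.
  rewrite /B; lra.
have B0 : 0 < B by rewrite /B; lra.
have nchiB : ~ chi B by apply: chiM; rewrite gtr0_norm// /B; lra.
have nchiNB : ~ chi (- B) by apply: chiM; rewrite normrN gtr0_norm// /B; lra.
have := locally_constant (- B) B Psi_const.
rewrite /Psi (asboolF nchiB) (asboolF nchiNB) !add0r => e.
transitivity (\sum_(i | Q i) g i B); last rewrite -e; [apply: eq_bigr|apply: big1] => i _;
  have /andP[h1 h2] := sB i.
  by rewrite /g h2 (lt_eqF h2) mulr1 addr0.
by rewrite /g (gt_eqF h1) (ltNge (s i)) (ltW h1) mulr0 addr0.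
Qed.

End crossing_count.

Section frame.
Context (R : realType) (n : nat).
Variables (F : 'M[R]_(n, n.+1)) (m : 'rV[R]_n.+1).
Hypotheses (FF : F *m F^T = 1%:M) (Fm : F *m m^T = 0) (mm : dot m m = 1).

Lemma frame_orthogonal :
  (col_mx m F : 'M[R]_n.+1) *m (col_mx m F : 'M[R]_n.+1)^T = 1%:M.
Proof.
rewrite (tr_col_mx m F) (mul_col_row m F m^T F^T) FF Fm.
have -> : m *m m^T = 1%:M by rewrite [LHS]mx11_scalar -/(dot m m) mm.
have -> : m *m F^T = 0 by rewrite -[LHS]trmxK trmx_mul trmxK Fm trmx0.
by rewrite -scalar_mx_block.
Qed.

Lemma frame_complete : F^T *m F = 1%:M - m^T *m m.
Proof.
have := mulmx1C frame_orthogonal.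
rewrite (tr_col_mx m F) (mul_row_col m^T F^T m F) => <-.
by rewrite [m^T *m m + _]addrC addrK.
Qed.

(** An orthogonal matrix coincides with its cofactor matrix up to sign, and here the
    cofactors of the first row are minors of [F]. *)
Lemma det_frame k : `|\det (col' k F)| = `|m ord0 k|.
Proof.
pose M : 'M[R]_n.+1 := col_mx m F.
have MM : M *m M^T = 1%:M := frame_orthogonal.
have d2 : `|\det M| = 1.
  have : \det M * \det M = 1 by rewrite -{2}det_tr -det_mulmx MM det1.
  by move=> h; apply/eqP; rewrite -(@eqrXn2 _ 2)// expr1n real_normK ?num_real// expr2 h.
have adjE : \adj M = \det M *: M^T.
  have MM' : M^T *m M = 1%:M by apply: mulmx1C.
  by rewrite -[LHS]mul1mx -MM' -mulmxA mul_mx_adj mul_mx_scalar.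
have := congr1 (fun A : 'M[R]_n.+1 => `|A k ord0|) adjE.
rewrite !mxE [in RHS]normrM d2 mul1r /cofactor normrM normrX normrN1 expr1n mul1r.
have -> : row' ord0 (col' k M) = col' k F.
  apply/matrixP => i j; rewrite !mxE.
  case: splitP => [i0|i0 /= /eqP]; first by case: i0 => [[]].
  by rewrite /bump /= add1n eqSS => /eqP /val_inj <-.
move=> ->; congr `| _ |.
case: splitP => [i0 _|i0]; last by [].
by rewrite ord1.
Qed.

End frame.

Section segments.
Context (R : realType) (n : nat) (K : set 'rV[R]_n).
Hypothesis oK : open K.

Lemma open_bdryN x : bdry K x -> ~ K x.
Proof. by move=> [_ ni] Kx; apply: ni; exact: open_nbhs_nbhs. Qed.

Lemma off_bdry_near x : ~ bdry K x ->
  exists2 e : R, 0 < e & forall y : 'rV[R]_n,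
    (forall i, `|y ord0 i - x ord0 i| < e) -> (K y <-> K x).
Proof.
move=> nbx; have [Kx|nKx] := pselect (K x).
  by have [e e0 he] := open_coorP oK Kx; exists e => // y /he.
have ncl : (~` closure K) x.
  move=> cx; apply: nbx; split => //; move=> ix; apply: nKx.
  exact: interior_subset ix.
have [e e0 he] := open_coorP (closed_openC (@closed_closure _ K)) ncl.
exists e => // y /he ny; split=> // Ky; exfalso; apply: ny.
exact: subset_closure.
Qed.

(** Otherwise membership would be locally constant along the segment. *)
Lemma segment_meets_bdry p q : K p -> ~ K q ->
  exists2 t : R, 0 <= t <= 1 & bdry K (p + t *: (q - p)).
Proof.
move=> Kp nKq; apply: contrapT => /forall2NP nb.
(* clamping the parameter extends the segment to a map on the whole line *)
pose clamp (t : R) := if t < 0 then 0 else if 1 < t then 1 else t.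
have clamp01 t : 0 <= clamp t <= 1.
  by rewrite /clamp; case: (ltrP t 0) => ?; [|case: (ltrP 1 t) => ?]; apply/andP; split; lra.
have clampL t x : `|clamp t - clamp x| <= `|t - x|.
  have h1 := ler_norm (t - x); have h2 := ler_norm (x - t); rewrite distrC in h2.
  by rewrite /clamp ler_norml; case: (ltrP t 0) => ?; [|case: (ltrP 1 t) => ?];
    (case: (ltrP x 0) => ?; [|case: (ltrP 1 x) => ?]); apply/andP; split; lra.
pose z t := p + clamp t *: (q - p).
pose f t : R := (`[< K (z t) >])%:R.
have : f 0 = f 1.
  apply: locally_constant => x.
  have [|e e0 he] := @off_bdry_near (z x).
    by have [//|] := nb (clamp x).
  pose B := 1 + \sum_i `|(q - p) ord0 i|.
  have B0 : 0 < B by rewrite /B ltr_pwDl// sumr_ge0.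
  exists (e / B); first by rewrite divr_gt0.
  move=> t; rewrite ltr_pdivlMr// => tx.
  have [] := he (z t); last first.
    move=> h1 h2; congr (nat_of_bool _)%:R.
    by apply/asboolP/asboolP; [exact: h1|exact: h2].
  move=> i; have -> : z t ord0 i - z x ord0 i = (clamp t - clamp x) * (q - p) ord0 i.
    by rewrite /z !mxE; ring.
  rewrite normrM; apply: le_lt_trans tx; apply: ler_pM => //.
  by rewrite /B (bigD1 i)//= addrCA lerDl addr_ge0// sumr_ge0.
rewrite /f /z; have -> : clamp 0 = 0 by rewrite /clamp ltxx; case: ltrP => //; lra.
have -> : clamp 1 = 1 by rewrite /clamp ltxx; case: ltrP => //; lra.
rewrite scale0r addr0 scale1r [p + _]addrC subrK (asboolT Kp) (asboolF nKq) /=.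
by move=> /eqP; rewrite oner_eq0.
Qed.

End segments.

Section face_closure.
Context (R : realType) (n : nat).
Variables (D : set 'rV[R]_n) (b : 'rV[R]_n.+1) (F : 'M[R]_(n, n.+1)) (m : 'rV[R]_n.+1).
Hypotheses (FF : F *m F^T = 1%:M) (Fm : F *m m^T = 0) (mm : dot m m = 1).
Local Notation par y := (b + y *m F).
Local Notation S := ((fun y => par y) @` D).

Lemma dotDr p (u v w : 'rV[R]_p) : dot u (v + w) = dot u v + dot u w.
Proof. by rewrite /dot raddfD mulmxDr mxE. Qed.

Lemma dotC p (u v : 'rV[R]_p) : dot u v = dot v u.
Proof. by rewrite !dotE; apply: eq_bigr => i _; rewrite mulrC. Qed.

Lemma dotZr p (u v : 'rV[R]_p) c : dot u (c *: v) = c * dot u v.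
Proof. by rewrite /dot linearZ -scalemxAr mxE. Qed.

Lemma dot0l p (u : 'rV[R]_p) : dot 0 u = 0.
Proof. by rewrite /dot mul0mx mxE. Qed.

Lemma dot_sum p (u : 'rV[R]_p) (I : finType) (P : pred I) (v : I -> 'rV[R]_p) :
  dot u (\sum_(i | P i) v i) = \sum_(i | P i) dot u (v i).
Proof. by rewrite /dot raddf_sum /= mulmx_sumr summxE. Qed.

Lemma dotNr p (u v : 'rV[R]_p) : dot u (- v) = - dot u v.
Proof. by rewrite -scaleN1r dotZr mulN1r. Qed.

Lemma dotNl p (u v : 'rV[R]_p) : dot (- u) v = - dot u v.
Proof. by rewrite dotC dotNr dotC. Qed.

Lemma dot_par y : dot m (par y) = dot m b.
Proof.
rewrite dotDr /dot trmx_mul mulmxA.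
have -> : m *m F^T = 0 by rewrite -[LHS]trmxK trmx_mul trmxK Fm trmx0.
by rewrite mul0mx [in X in _ + X]mxE addr0.
Qed.

Lemma closure_face_plane z : closure S z -> dot m z = dot m b.
Proof.
have cH : closed (dot m @^-1` [set dot m b]).
  by apply: closed_preimageT; [exact: continuous_dot|exact: closed_eq].
have SH : S `<=` dot m @^-1` [set dot m b] by move=> _ [y _ <-]; exact: dot_par.
by move=> /(closureS SH); rewrite -((closure_id _).1 cH).
Qed.

(** The transpose of the frame inverts the parametrization on its hyperplane. *)
Lemma closure_face z : closure S z -> exists2 y, closure D y & z = par y.
Proof.
move=> cz; exists ((z - b) *m F^T); last first.
  rewrite -mulmxA (frame_complete FF Fm mm) mulmxBr mulmx1 mulmxA.
  have -> : (z - b) *m m^T = 0.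
    rewrite [LHS]mx11_scalar -/(dot (z - b) m) dotC dotDr dotNr.
    by rewrite closure_face_plane// subrr raddf0.
  by rewrite mul0mx subr0 addrC subrK.
move=> B nB; pose pr (z : 'rV[R]_n.+1) := z *m F^T + (- (b *m F^T)).
have prE x : pr x = (x - b) *m F^T by rewrite mulmxBl.
have nB' : nbhs z (pr @^-1` B).
  by apply: (@continuous_mulmxD R _ _ F^T (- (b *m F^T)) z); rewrite -/(pr z) prE.
have [_ [[y Dy <-] By]] := cz _ nB'.
exists y; split => //; move: By; rewrite /preimage /= prE [b + _]addrC addrK.
by rewrite -mulmxA FF mulmx1.
Qed.

End face_closure.

Section local_side.
Context (R : realType) (n : nat) (K : set 'rV[R]_n) (z m : 'rV[R]_n) (S : set 'rV[R]_n).
Hypotheses (oK : open K) (mm : dot m m = 1).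

(** Near a point of one face only, the boundary lies in the hyperplane of that
    face, so a half ball on either side of the hyperplane does not meet it.  The
    normal direction decides on which side the set is; any other transversal
    direction leads into the same half ball. *)
Lemma transversal_sides (v : 'rV[R]_n) :
  bdry K z -> outward_on K S m -> S z ->
  (exists2 rho : R, 0 < rho & forall y : 'rV[R]_n,
     (forall i, `|y ord0 i - z ord0 i| < rho) -> bdry K y -> dot m y = dot m z) ->
  0 < dot m v ->
  exists2 e : R, 0 < e & forall t, 0 < t < e -> K (z - t *: v) /\ ~ K (z + t *: v).
Proof.
move=> bz out Sz [rho rho0 hrho] mv.
have [r r0 hr] := out _ Sz.
pose B := 1 + \sum_i (`|v ord0 i| + `|m ord0 i|).
have sum0 : 0 <= \sum_i (`|v ord0 i| + `|m ord0 i|) by apply: sumr_ge0 => i _; exact: addr_ge0.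
have B0 : 0 < B by rewrite /B; lra.
have Bv i : `|v ord0 i| <= B /\ `|m ord0 i| <= B.
  have : `|v ord0 i| + `|m ord0 i| <= \sum_i (`|v ord0 i| + `|m ord0 i|).
    by rewrite (bigD1 i)//= lerDl sumr_ge0// => j _; exact: addr_ge0.
  have := normr_ge0 (v ord0 i); have := normr_ge0 (m ord0 i); rewrite /B; lra.
pose s := Num.min r (rho / B) / 2.
have s0 : 0 < s by rewrite divr_gt0// lt_min r0 divr_gt0.
have sr : s < r.
  have : Num.min r (rho / B) <= r by rewrite ge_min lexx.
  rewrite /s; lra.
have sB : s < rho / B.
  have : Num.min r (rho / B) <= rho / B by rewrite ge_min lexx orbT.
  have : 0 < rho / B by rewrite divr_gt0.
  rewrite /s; lra.
clearbody s; exists (rho / B); first by rewrite divr_gt0.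
move=> t /andP[t0 tB].
have offplane (sg th : R) : `|sg| = 1 -> 0 <= th <= 1 ->
    ~ bdry K (z + sg *: (((1 - th) * s) *: m + (th * t) *: v)).
  move=> sg1 /andP[th0 th1] hb; have c1 : 0 <= (1 - th) * s by rewrite mulr_ge0//; lra.
  have c2 : 0 <= th * t by rewrite mulr_ge0// ltW.
  have := hrho _ _ hb; rewrite dotDr dotZr dotDr !dotZr mm mulr1.
  have pos : 0 < (1 - th) * s + th * t * dot m v.
    have [->|thn] := eqVneq th 0; first by rewrite subr0 !mul0r mul1r addr0.
    rewrite ltr_pwDr// mulr_gt0// mulr_gt0// lt_def thn th0 //.
  have sg0 : sg != 0 by rewrite -normr_eq0 sg1 oner_eq0.
  move=> h; have : sg * ((1 - th) * s + th * t * dot m v) = 0.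
    apply: (addrI (dot m z)); rewrite addr0; apply: h => i.
    rewrite !mxE [X in `|X|]addrAC subrr add0r normrM sg1 mul1r.
    have [h1 h2] := Bv i.
    apply: le_lt_trans (ler_normD _ _) _.
    rewrite !(normrM (_ * _)) (ger0_norm c1) (ger0_norm c2).
    have : s * B < rho by rewrite -ltr_pdivlMr.
    have : t * B < rho by rewrite -ltr_pdivlMr.
    have : (1 - th) * s * `|m ord0 i| <= (1 - th) * (s * B).
      by rewrite mulrA; apply: ler_wpM2l.
    have : th * t * `|v ord0 i| <= th * (t * B) by rewrite mulrA; apply: ler_wpM2l.
    have [h3|/ltW h3] := leP (s * B) (t * B).
      have : 0 <= (1 - th) * (t * B - s * B) by rewrite mulr_ge0//; lra.
      lra.
    have : 0 <= th * (s * B - t * B) by rewrite mulr_ge0//; lra.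
    lra.
  by move=> /eqP; rewrite mulf_eq0 (negbTE sg0) gt_eqF.
have [Ka nKa] : K (z - s *: m) /\ ~ K (z + s *: m) by apply: hr; rewrite s0.
split.
  apply: contrapT => nKc; have [th th01] := segment_meets_bdry oK Ka nKc.
  rewrite (_ : _ + _ = z + (-1) *: (((1 - th) * s) *: m + (th * t) *: v)).
    by apply: offplane; rewrite // normrN1.
  by apply/rowP => i; rewrite !mxE; ring.
move=> Kc; have [th th01] := segment_meets_bdry oK Kc nKa.
rewrite (_ : _ + _ = z + 1 *: (((1 - (1 - th)) * s) *: m + ((1 - th) * t) *: v)).
  by apply: offplane; [rewrite normr1|move: th01; lra].
by apply/rowP => i; rewrite !mxE; ring.
Qed.

End local_side.

Section vertical_lines.
Context (R : realType) (n : nat) (k : 'I_n.+1).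

Definition axis_line (y : 'rV[R]_n) (s : R) : 'rV[R]_n.+1 :=
  \row_j oapp (y ord0) s (unlift k j).

Lemma axis_line_k y s : axis_line y s ord0 k = s.
Proof. by rewrite mxE unlift_none. Qed.

Lemma axis_line_proj y s : col' k (axis_line y s) = y.
Proof. by apply/rowP => j; rewrite !mxE liftK. Qed.

Lemma axis_lineE (z : 'rV[R]_n.+1) : z = axis_line (col' k z) (z ord0 k).
Proof.
apply/rowP => j; rewrite mxE; case: unliftP => [i ->|->] //=.
by rewrite mxE.
Qed.

Lemma axis_line_shift y s t : axis_line y (s + t) = axis_line y s + t *: delta_mx ord0 k.
Proof.
apply/rowP => j; rewrite !mxE; case: unliftP => [i ->|->] /=.
  by rewrite [lift k i == k]eq_sym eq_liftF ?andbF mulr0 addr0.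
by rewrite !eqxx mulr1.
Qed.

Lemma dot_delta (m : 'rV[R]_n.+1) : dot m (delta_mx ord0 k) = m ord0 k.
Proof.
rewrite dotE (bigD1 k)//= big1 ?addr0.
  by rewrite mxE !eqxx mul1r.
by move=> j /negbTE jk; rewrite mxE jk andbF mul0r.
Qed.

End vertical_lines.

Section shadow.
Context (R : realType) (n : nat) (k : 'I_n.+1).
Variables (b : 'rV[R]_n.+1) (F : 'M[R]_(n, n.+1)) (m : 'rV[R]_n.+1).
Hypotheses (FF : F *m F^T = 1%:M) (Fm : F *m m^T = 0) (mm : dot m m = 1).
Local Notation par y := (b + y *m F).

Lemma proj_par (y : 'rV[R]_n) : col' k (par y) = y *m col' k F + col' k b.
Proof.
apply/rowP => j; rewrite !mxE addrC; congr (_ + _).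
by apply: eq_bigr => i _; rewrite mxE.
Qed.

Lemma shadow_unit : m ord0 k != 0 -> col' k F \in unitmx.
Proof.
move=> mk; rewrite unitmxE unitfE -normr_eq0 (det_frame FF Fm mm k).
by rewrite normr_eq0.
Qed.

Lemma shadow_preimage (D : set 'rV[R]_n) : m ord0 k != 0 ->
  [set col' k (par y) | y in D] =
  [set x | D (x *m invmx (col' k F) + (- (col' k b *m invmx (col' k F))))].
Proof.
move=> mk; have uA := shadow_unit mk; set A := col' k F.
apply/seteqP; split => x /=.
  by move=> [y Dy <-]; rewrite proj_par mulmxDl addrK mulmxK.
move=> Dx; eexists; first exact: Dx.
by rewrite proj_par mulmxDl mulNmx !mulmxKV// subrK.
Qed.

Lemma measurable_shadow (D : set 'rV[R]_n) : m ord0 k != 0 -> measurable D ->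
  measurable [set col' k (par y) | y in D].
Proof.
move=> mk mD; rewrite shadow_preimage//.
exact: measurable_preimageT (measurable_mulmx _ _) mD.
Qed.

Lemma leb_shadow (D : set 'rV[R]_n) : m ord0 k != 0 -> measurable D ->
  leb R n [set col' k (par y) | y in D] = (`|m ord0 k|%:E * leb R n D)%E.
Proof.
move=> mk mD; rewrite shadow_preimage//; have uA := shadow_unit mk.
have uA' : invmx (col' k F) \in unitmx by rewrite unitmx_inv.
rewrite -(leb_affine (- (col' k b *m invmx (col' k F))) uA' mD).
rewrite muleA -EFinM det_inv normfV (det_frame FF Fm mm k) divff ?mul1e//.
by rewrite normr_eq0.
Qed.

Lemma shadow_negligible (N : set 'rV[R]_n) : m ord0 k != 0 ->
  (leb R n).-negligible N -> (leb R n).-negligible [set col' k (par y) | y in N].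
Proof.
move=> mk [B [mB B0 NB]]; exists [set col' k (par y) | y in B]; split.
- exact: measurable_shadow.
- by rewrite leb_shadow// B0 mule0.
- by move=> _ [y Ny <-]; exists y => //; exact: NB.
Qed.

(** A face parallel to the axis is projected by a singular map, into a hyperplane. *)
Lemma vertical_shadow_negligible (N : set 'rV[R]_n) : m ord0 k = 0 ->
  (leb R n).-negligible [set col' k (par y) | y in N].
Proof.
move=> mk.
have : \det (col' k F)^T == 0.
  by rewrite det_tr -normr_eq0 (det_frame FF Fm mm k) mk normr0.
move=> /det0P[v v0 vA].
apply: negligibleS (hyperplane_null (dot v (col' k b)) v0) => _ [y _ <-] /=.
rewrite proj_par dotDr; suff -> : dot v (y *m col' k F) = 0 by rewrite add0r.
by rewrite /dot trmx_mul mulmxA vA mul0mx mxE.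
Qed.

End shadow.

Section balance.
Context (R : realType) (n : nat) (I : finType) (Q : pred I).
Context (K : set 'rV[R]_n.+1) (D : I -> set 'rV[R]_n) (b : I -> 'rV[R]_n.+1).
Context (F : I -> 'M[R]_(n, n.+1)) (m : I -> 'rV[R]_n.+1).
Local Notation par i y := (b i + y *m F i).
Local Notation S i := ((fun y => par i y) @` D i).
Hypotheses (oK : open K) (bK : bounded_set K).
Hypothesis hD : forall i, Q i -> open_polytope (D i).
Hypothesis hF : forall i, Q i ->
  [/\ F i *m (F i)^T = 1%:M, F i *m (m i)^T = 0 & dot (m i) (m i) = 1].
Hypothesis hout : forall i, Q i -> outward_on K (S i) (m i).
Hypothesis hbd : bdry K = \bigcup_(i in [set i | Q i]) closure (S i).
Hypothesis hdis : forall i j, Q i -> Q j -> i != j -> S i `&` S j = set0.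

(** [y] determines the line of all [z] with [col' k z = y]; it is good if it meets the
    closed faces only in their relative interiors, and transversally. *)
Let good k (y : 'rV[R]_n) := forall i z, Q i -> closure (S i) z ->
  col' k z = y -> S i z /\ m i ord0 k != 0.

(** The exceptional lines pass through the relative boundary of a face or through a
    face parallel to them. *)
Lemma generic_lines k : (leb R n).-negligible [set y | ~ good k y].
Proof.
pose bad i := [set y | Q i /\ exists z, [/\ closure (S i) z, col' k z = y &
  ~ (S i z /\ m i ord0 k != 0)]].
suff nbad i : (leb R n).-negligible (bad i).
  apply: negligibleS (negligible_finType nbad) => y /existsNP[i].
  move=> /existsNP[z /not_implyP[Qi /not_implyP[cz /not_implyP[zy h]]]].
  by exists i => //; split => //; exists z.
have [Qi|nQi] := boolP (Q i); last first.
  by apply: negligibleS (negligible_set0 _) => y [Qi]; rewrite Qi in nQi.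
have [FF Fm mm] := hF Qi.
have [mk|mk] := eqVneq (m i ord0 k) 0.
  apply: negligibleS (vertical_shadow_negligible (b i) FF Fm mm setT mk) => y.
  move=> [_ [z [cz <- _]]].
  by have [y0 _ ->] := closure_face FF Fm mm cz; exists y0.
apply: negligibleS
  (shadow_negligible (b i) FF Fm mm mk (open_polytope_boundary_null (hD Qi))) => y.
move=> [_ [z [cz <- nS]]]; have [y0 cy0 zE] := closure_face FF Fm mm cz.
exists y0; last by rewrite zE.
by split => // Dy0; apply: nS; split => //; exists y0.
Qed.

(** A good line meets each face at most once, and there it leaves the cell or enters it
    according to the sign of the component of the outward normal along the line. *)
Lemma balanced_crossings k y : good k y ->
  \sum_(i | Q i && `[< exists s, S i (axis_line k y s) >]) Num.sg (m i ord0 k) = 0.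
Proof.
move=> gy.
have [M [_ KM]] := bK.
pose hit i : R := xget 0 [set s | S i (axis_line k y s)].
pose Q' i := Q i && `[< exists s, S i (axis_line k y s) >].
have hitP i : Q' i -> S i (axis_line k y (hit i)).
  move=> /andP[_ /asboolP[s Ss]].
  exact: (@xgetPex _ 0 [set s | S i (axis_line k y s)] (ex_intro _ s Ss)).
have Smk i s : Q i -> S i (axis_line k y s) -> m i ord0 k != 0.
  move=> Qi Ss.
  by have [] := gy i (axis_line k y s) Qi (subset_closure Ss) (axis_line_proj _ _ _).
have Suniq i s t : Q i -> S i (axis_line k y s) -> S i (axis_line k y t) -> s = t.
  move=> Qi Ss St; have [FF Fm mm] := hF Qi.
  have := closure_face_plane Fm (subset_closure Ss).
  rewrite -(closure_face_plane Fm (subset_closure St)).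
  rewrite -{1}(subrK t s) addrC axis_line_shift dotDr => /eqP.
  rewrite -subr_eq0 addrAC subrr add0r dotZr dot_delta mulf_eq0.
  by rewrite (negbTE (Smk i s Qi Ss)) orbF subr_eq0 => /eqP.
apply: (@crossing_count R I Q' (fun s => K (axis_line k y s)) hit _ (M + 1)).
- move=> i j Qi Qj hij; apply/eqP; apply: contrapT => /negP ij.
  have /andP[Qi' _] := Qi; have /andP[Qj' _] := Qj.
  have : (S i `&` S j) (axis_line k y (hit i)).
    by split; [exact: hitP|rewrite hij; exact: hitP].
  by rewrite hdis.
- move=> i Q'i; have Sz := hitP i Q'i; have /andP[Qi _] := Q'i.
  set z := axis_line k y (hit i) in Sz *.
  have [FF Fm mm] := hF Qi; have mk := Smk i _ Qi Sz.
  have bz : bdry K z by rewrite hbd; exists i => //; exact: subset_closure.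
  have mv : 0 < dot (m i) (Num.sg (m i ord0 k) *: delta_mx ord0 k).
    by rewrite dotZr dot_delta -normrEsg normr_gt0.
  have near_z : \forall x \near z, forall j, Q j -> j != i -> ~ closure (S j) x.
    apply: (@near_finType _ _ (nbhs z)) => j.
    have [jc|njc] := pselect (Q j /\ j != i); last first.
      by apply: (@filterE _ (nbhs z)) => x Qj ji; exfalso; apply: njc.
    have [Qj ji] := jc.
    have ncj : (~` closure (S j)) z.
      move=> cj; have [Sj _] := gy j z Qj cj (axis_line_proj _ _ _).
      by have : (S j `&` S i) z by []; rewrite hdis.
    have := open_nbhs_nbhs (conj (closed_openC (@closed_closure _ (S j))) ncj).
    by apply: filterS.
  have {}near_z : exists2 rho : R, 0 < rho & forall x : 'rV[R]_n.+1,
      (forall l, `|x ord0 l - z ord0 l| < rho) -> bdry K x -> dot (m i) x = dot (m i) z.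
    have /near_coorP[rho rho0 hrho] := near_z; exists rho => // x xz.
    rewrite hbd => -[j /= Qj cj]; have [ji|ji] := eqVneq j i; last first.
      by exfalso; apply: (hrho x xz j Qj ji).
    move: cj; rewrite ji => ci.
    by rewrite (closure_face_plane Fm ci) (closure_face_plane Fm (subset_closure Sz)).
  split.
  + have [mp|mp|me] := ltrgtP (m i ord0 k) 0; last by rewrite me eqxx in mk.
      by right; rewrite ltr0_sg.
    by left; rewrite gtr0_sg.
  + exact: open_bdryN bz.
  + have [e e0 he] := transversal_sides oK mm bz (hout Qi) Sz near_z mv.
    exists e => // t /he; rewrite !axis_line_shift -/z scaleNr !scalerA.
    by rewrite [t * _]mulrC.
- move=> x nhit.
  have nbx : ~ bdry K (axis_line k y x).
    rewrite hbd => -[j /= Qj cj]; have [Sj _] := gy j _ Qj cj (axis_line_proj _ _ _).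
    have Q'j : Q' j by rewrite /Q' Qj; apply/asboolP; exists x.
    by have := nhit j Q'j; rewrite (Suniq j _ _ Qj (hitP j Q'j) Sj) eqxx.
  have [e e0 he] := off_bdry_near oK nbx; exists e => // t tx; apply: he => l.
  rewrite !mxE; case: unliftP => [j _|_] //=.
  by rewrite subrr normr0.
- move=> x Mx Kx; have MM : M < M + 1 by rewrite ltrDl.
  have := KM _ MM _ Kx; apply/negP; rewrite -ltNge; apply: lt_le_trans Mx _.
  by rewrite -{1}(axis_line_k k y x); exact: coor_le_norm.
Qed.

End balance.

(** Integrate the signed sum of indicator functions. *)
Lemma cancelling_sets d (T : measurableType d) (R : realType)
    (mu : {measure set T -> \bar R}) (I : finType) (A : I -> set T) (c : I -> R) :
  (forall i, measurable (A i)) -> (forall i, mu (A i) < +oo)%E ->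
  mu.-negligible [set x | \sum_i c i * \1_(A i) x <> 0] ->
  \sum_i c i * fine (mu (A i)) = 0.
Proof.
move=> mA fA nz.
have i1 i : mu.-integrable setT (fun x => (\1_(A i) x)%:E).
  apply/integrableP; split; first exact/measurable_EFinP/measurable_indic.
  under eq_integral do rewrite gee0_abs ?lee_fin//.
  by rewrite integral_indic// setIT.
have iA i : mu.-integrable setT (fun x => (c i * \1_(A i) x)%:E).
  under eq_fun do rewrite EFinM.
  exact: integrableZl.
have mA' i : measurable_fun [set: T] (fun x => c i * \1_(A i) x).
  by apply: measurable_funM => //; exact: measurable_indic.
have : (\int[mu]_x (\sum_i (c i * \1_(A i) x)%:E) = 0)%E.
  rewrite -[RHS](integral0 mu setT); apply: ae_eq_integral => //.
    under eq_fun do rewrite sumEFin.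
    by apply/measurable_EFinP; exact: measurable_sum.
  apply: negligibleS nz => x /= /not_implyP[_ h] h0; apply: h.
  by rewrite sumEFin h0.
rewrite integral_sum// => h; apply: EFin_inj.
rewrite -sumEFin -[RHS]h; apply: eq_bigr => i _.
under [RHS]eq_integral do rewrite EFinM.
rewrite integralZl//.
by rewrite integral_indic// setIT EFinM fineK// ge0_fin_numE.
Qed.

Section faces_balance.
Context (R : realType) (n : nat) (I : finType) (Q : pred I).
Context (K : set 'rV[R]_n.+1) (D : I -> set 'rV[R]_n) (b : I -> 'rV[R]_n.+1).
Context (F : I -> 'M[R]_(n, n.+1)) (m : I -> 'rV[R]_n.+1).
Local Notation S i := ((fun y => b i + y *m F i) @` D i).

(** Each component of the sum is an integral over the lines parallel to a
    coordinate axis: a face of normal [m] and area [a] casts a shadow of area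
    [`|m_k| * a], and almost every line enters and leaves the cell equally often. *)
Theorem faces_balance : open K -> bounded_set K ->
  (forall i, Q i -> open_polytope (D i)) ->
  (forall i, Q i ->
    [/\ F i *m (F i)^T = 1%:M, F i *m (m i)^T = 0 & dot (m i) (m i) = 1]) ->
  (forall i, Q i -> outward_on K (S i) (m i)) ->
  bdry K = \bigcup_(i in [set i | Q i]) closure (S i) ->
  (forall i j, Q i -> Q j -> i != j -> S i `&` S j = set0) ->
  \sum_(i | Q i) fine (leb R n (D i)) *: m i = 0.
Proof.
move=> oK bK hD hF hout hbd hdis; apply/rowP => k.
rewrite summxE mxE; pose Q' i := Q i && (m i ord0 k != 0).
pose A i := if Q' i then [set col' k (b i + y *m F i) | y in D i] else set0.
pose c i := if Q' i then Num.sg (m i ord0 k) else 0.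
have mA i : measurable (A i).
  rewrite /A; case: ifP => // /andP[Qi mk]; have [FF Fm mm] := hF _ Qi.
  by apply: (measurable_shadow (b i) FF Fm mm mk); exact: open_polytope_measurable (hD _ Qi).
have AE i : Q' i -> leb R n (A i) = (`|m i ord0 k|%:E * leb R n (D i))%E.
  move=> Q'i; rewrite /A Q'i; have /andP[Qi mk] := Q'i; have [FF Fm mm] := hF _ Qi.
  by apply: (leb_shadow (b i) FF Fm mm mk); exact: open_polytope_measurable (hD _ Qi).
have Dfin i : Q i -> leb R n (D i) \is a fin_num.
  by move=> Qi; rewrite ge0_fin_numE//; exact: open_polytope_leb_fin (hD _ Qi).
have Afin i : (leb R n (A i) < +oo)%E.
  have [Q'i|] := boolP (Q' i); last by rewrite /A => /negbTE ->; rewrite measure0.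
  rewrite AE//; have /andP[Qi _] := Q'i.
  by apply: lte_mul_pinfty => //; rewrite -ge0_fin_numE// Dfin.
have := cancelling_sets mA Afin; move=> /(_ c) h.
transitivity (\sum_i c i * fine (leb R n (A i))); last first.
  apply: h; apply: negligibleS (generic_lines b hD hF k) => y /= nz gy; apply: nz.
  have := balanced_crossings oK bK hF hout hbd hdis gy => cr.
  transitivity (\sum_(i | Q i && `[< exists s, S i (axis_line k y s) >]) Num.sg (m i ord0 k)).
    rewrite [RHS]big_mkcond /=; apply: eq_bigr => i _; rewrite /c /A indicE.
    rewrite /Q'; have [Qi|_] := boolP (Q i); last by rewrite mul0r.
    have [mk|mk] /= := eqVneq (m i ord0 k) 0.
      by rewrite mk sgr0 mul0r; case: ifP.
    case: asboolP => [[s [y0 Dy0 ys]]|nS].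
      rewrite mem_set ?mulr1//; exists y0 => //.
      by rewrite ys axis_line_proj.
    rewrite memNset ?mulr0// => -[y0 Dy0 y0E]; apply: nS.
    by exists ((b i + y0 *m F i) ord0 k); exists y0 => //; rewrite -y0E -axis_lineE.
  exact: cr.
rewrite [RHS](bigID Q) /= [X in _ = _ + X]big1 ?addr0; last first.
  by move=> i /negbTE nQ; rewrite /c /Q' nQ mul0r.
apply: eq_bigr => i Qi; rewrite mxE /c; case: ifPn => Q'i.
  rewrite AE// fineM ?Dfin//= mulrA [in RHS]mulrC; congr (_ * _).
  exact: numEsg.
move: Q'i; rewrite /Q' Qi /= negbK => /eqP ->.
by rewrite mulr0 mul0r.
Qed.

End faces_balance.

(** * Weighted averages contract the mean square *)

Section averages.
Context (R : realType).

(** Convexity of the square; the weight missing to 1 is carried by the value 0. *)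
Lemma weighted_mean_sqr (E : finType) (P : pred E) (p0 x : R) (p y : E -> R) :
  0 <= p0 -> (forall e, P e -> 0 <= p e) -> p0 + \sum_(e | P e) p e <= 1 ->
  (p0 * x + \sum_(e | P e) p e * y e) ^+ 2 <=
  p0 * x ^+ 2 + \sum_(e | P e) p e * y e ^+ 2.
Proof.
move=> p00 pge ple; set m := p0 * x + _.
have : 0 <= p0 * (x - m) ^+ 2 + \sum_(e | P e) p e * (y e - m) ^+ 2.
  apply: addr_ge0; first by rewrite mulr_ge0 ?sqr_ge0.
  by apply: sumr_ge0 => e Pe; rewrite mulr_ge0 ?sqr_ge0// pge.
have -> : \sum_(e | P e) p e * (y e - m) ^+ 2 = \sum_(e | P e) p e * y e ^+ 2
    - 2 * m * \sum_(e | P e) p e * y e + m ^+ 2 * \sum_(e | P e) p e.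
  rewrite !mulr_sumr -sumrB -big_split /=; apply: eq_bigr => e _; ring.
have mE : \sum_(e | P e) p e * y e = m - p0 * x by rewrite /m addrC addKr.
rewrite mE; clearbody m; have m2 := sqr_ge0 m.
have : 0 <= m ^+ 2 * (1 - (p0 + \sum_(e | P e) p e)) by rewrite mulr_ge0// subr_ge0.
nra.
Qed.

(** [w] are the cell volumes, [u] the cell values, and [D] the same values in the
    scaling that turns the [L2] norm into the Euclidean one; [A K e] is the rate at which [u K] leaves
    the cell [K] through [e] and [B K e] the rate at which the neighbouring value
    enters.  Equal row sums and the time step bound make the update a convex
    combination, and what enters a cell has left another one. *)
Lemma update_contraction (C E : finType) (fo : C -> E -> bool)
    (nb : C -> E -> option C) (w D u : C -> R) (A B : C -> E -> R) (r : C -> R) (tau : R) :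
  0 <= tau -> (forall K, 0 <= w K) ->
  (forall K e, fo K e -> 0 <= B K e) ->
  (forall K, \sum_(e | fo K e) A K e = r K) ->
  (forall K, \sum_(e | fo K e) B K e = r K) ->
  (forall K, w K != 0 -> tau * r K <= w K) ->
  (forall f : C -> R, (forall K, 0 <= f K) ->
    \sum_K \sum_(e | fo K e) B K e * oapp f 0 (nb K e) <=
    \sum_K \sum_(e | fo K e) A K e * f K) ->
  (forall K, u K = D K / Num.sqrt (w K)) ->
  \sum_K (D K - tau * ((Num.sqrt (w K))^-1 *
    \sum_(e | fo K e) (A K e * u K - B K e * oapp u 0 (nb K e)))) ^+ 2 <=
  \sum_K D K ^+ 2.
Proof.
move=> tau0 w0 B0 sA sB cfl swap uE.
pose u2 K := u K ^+ 2.
have u2o o : (oapp u 0 o) ^+ 2 = oapp u2 0 o by case: o => //=; rewrite expr0n.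
apply: (@le_trans _ _ (\sum_K (D K ^+ 2 + tau *
   (\sum_(e | fo K e) B K e * oapp u2 0 (nb K e) - \sum_(e | fo K e) A K e * u2 K)))).
  apply: ler_sum => K _.
  rewrite -mulr_suml sA.
  have Buo0 : 0 <= \sum_(e | fo K e) B K e * oapp u2 0 (nb K e).
    apply: sumr_ge0 => e fe; rewrite mulr_ge0 ?B0//.
    by case: (nb K e) => //= K'; exact: sqr_ge0.
  (* for a cell of volume 0 the inverse of the volume is 0, and nothing is updated *)
  have [wK|wK] := eqVneq (w K) 0.
    rewrite wK sqrtr0 invr0 mul0r mulr0 subr0 lerDl mulr_ge0//.
    by rewrite /u2 uE wK sqrtr0 invr0 mulr0 expr0n mulr0 subr0.
  have wpos : 0 < w K by rewrite lt_def wK w0.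
  have sw : Num.sqrt (w K) ^+ 2 = w K by rewrite sqr_sqrtr.
  have swn : Num.sqrt (w K) != 0 by rewrite gt_eqF// sqrtr_gt0.
  have DE : D K = Num.sqrt (w K) * u K by rewrite uE mulrC divfK.
  rewrite sumrB -mulr_suml sA.
  set s := Num.sqrt (w K) in sw swn DE *.
  set sB' := \sum_(e | fo K e) B K e * oapp u 0 (nb K e).
  pose mean := (1 - tau * r K / w K) * u K +
    \sum_(e | fo K e) (tau / w K * B K e) * oapp u 0 (nb K e).
  have -> : D K - tau * (s^-1 * (r K * u K - sB')) = s * mean.
    rewrite /mean; under eq_bigr do rewrite -mulrA.
    by rewrite -mulr_sumr -/sB' DE -sw; field.
  have := @weighted_mean_sqr E (fo K) (1 - tau * r K / w K) (u K)
    (fun e => tau / w K * B K e) (fun e => oapp u 0 (nb K e)).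
  rewrite -/mean => h; have {}h : mean ^+ 2 <= (1 - tau * r K / w K) * u2 K +
      tau / w K * \sum_(e | fo K e) B K e * oapp u2 0 (nb K e).
    rewrite mulr_sumr; under [X in _ + X]eq_bigr do rewrite -u2o mulrA.
    apply: h.
    - by rewrite subr_ge0 ler_pdivrMr// mul1r cfl.
    - by move=> e fe; rewrite mulr_ge0 ?B0// divr_ge0.
    - by rewrite -mulr_sumr sB mulrAC subrK.
  rewrite exprMn sw; apply: le_trans (ler_wpM2l (ltW wpos) h) _.
  by rewrite DE exprMn sw -/(u2 K) le_eqVlt; apply/orP; left; apply/eqP; field.
rewrite big_split /= -mulr_sumr sumrB gerDl mulr_ge0_le0// subr_le0.
by apply: swap => K; exact: sqr_ge0.
Qed.

End averages.

(** * Integrals over the faces of a product mesh *)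

Section integrals.
Context (R : realType).

Lemma Rintegral_sum d (T : measurableType d) (mu : {measure set T -> \bar R})
    (D : set T) (I : Type) (s : seq I) (P : pred I) (f : I -> T -> R) :
  measurable D -> (forall i, P i -> mu.-integrable D (EFin \o f i)) ->
  Rintegral mu D (fun x => \sum_(i <- s | P i) f i x) =
  \sum_(i <- s | P i) Rintegral mu D (f i).
Proof.
move=> mD fi; elim: s => [|i s IHs].
  rewrite big_nil; under eq_Rintegral do rewrite big_nil.
  by rewrite Rintegral_cst// mul0r.
rewrite big_cons; under eq_Rintegral do rewrite big_cons.
have [Pi|nPi] := boolP (P i); last exact: IHs.
rewrite RintegralD ?IHs//; first exact: fi.
have := @integrable_sum _ _ _ mu D mD I s P (fun i x => (f i x)%:E) fi.
by apply: eq_integrable => // x _; rewrite /= sumEFin.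
Qed.

Lemma Rintegral_prod d1 d2 (T1 : measurableType d1) (T2 : measurableType d2)
    (m1 : {sigma_finite_measure set T1 -> \bar R})
    (m2 : {sigma_finite_measure set T2 -> \bar R})
    (A : set T1) (B : set T2) (f : T1 -> R) (g : T2 -> R) :
  measurable A -> measurable B ->
  m1.-integrable A (EFin \o f) -> m2.-integrable B (EFin \o g) ->
  (m1 \x m2)%E.-integrable (A `*` B) (fun p => (f p.1 * g p.2)%:E) ->
  Rintegral (m1 \x m2)%E (A `*` B) (fun p => f p.1 * g p.2) =
  Rintegral m1 A f * Rintegral m2 B g.
Proof.
move=> mA mB fi gi fgi.
have mAB : measurable (A `*` B) by exact: measurableX.
have restrE (p : T1 * T2) :
    ((fun p => f p.1 * g p.2) \_ (A `*` B)) p = (f \_ A) p.1 * (g \_ B) p.2.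
  rewrite !patchE; have [|] := boolP (p \in A `*` B).
    by rewrite inE => -[/mem_set -> /mem_set ->].
  move=> /negP nAB; case: ifPn => [pA|_]; last by rewrite mul0r.
  case: ifPn => [pB|_]; last by rewrite mulr0.
  by exfalso; apply: nAB; rewrite inE; split; exact: set_mem.
have fi' : m1.-integrable setT (fun x => ((f \_ A) x)%:E).
  have /(integrable_mkcond _ mA) := fi.
  by apply: eq_integrable => // x _; rewrite restrict_EFin.
have gi' : m2.-integrable setT (fun x => ((g \_ B) x)%:E).
  have /(integrable_mkcond _ mB) := gi.
  by apply: eq_integrable => // x _; rewrite restrict_EFin.
have fgi' : (m1 \x m2)%E.-integrable setT (fun p => ((f \_ A) p.1 * (g \_ B) p.2)%:E).
  have /(integrable_mkcond _ mAB) := fgi.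
  by apply: eq_integrable => // p _; rewrite -restrE restrict_EFin.
rewrite [LHS]Rintegral_mkcond (Rintegral_mkcond _ A) (Rintegral_mkcond _ B) /Rintegral.
under eq_integral do rewrite restrE.
rewrite -(integral12_prod_meas1 fgi') /fubini_F.
have gfin := integrable_fin_num measurableT gi'.
have ffin := integrable_fin_num measurableT fi'.
rewrite -fineM//; congr fine.
rewrite -[in RHS](fineK gfin) -integralZr//; apply: eq_integral => x _ /=.
by under eq_integral do rewrite EFinM; rewrite integralZl// -[in LHS](fineK gfin).
Qed.

Lemma bounded_integrable d (T : measurableType d) (mu : {measure set T -> \bar R})
    (D : set T) (f : T -> R) (C : R) :
  measurable D -> (mu D < +oo)%E -> measurable_fun D f ->
  (forall x, D x -> `|f x| <= C) -> mu.-integrable D (EFin \o f).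
Proof.
move=> mD fD mf fC; apply: measurable_bounded_integrable => //.
exists C; split; first exact: num_real.
by move=> M CM x Dx; exact: le_trans (fC _ Dx) (ltW CM).
Qed.

End integrals.

Section mesh_cells.
Context (R : realType) (n : nat) (Omega : set 'rV[R]_n.+1) (M : mesh R n.+1).
Hypothesis hM : is_mesh Omega M.

Lemma mesh_cell (i : 'I_(ncells M)) : open_polytope (cell i) /\ cell i `<=` Omega.
Proof. by have [h _ _ _ _] := hM. Qed.

Lemma mesh_cell_measurable (i : 'I_(ncells M)) : measurable (cell i).
Proof. exact: open_polytope_measurable (mesh_cell i).1. Qed.

Lemma mesh_cell_finite (i : 'I_(ncells M)) : (leb R n.+1 (cell i) < +oo)%E.
Proof. exact: open_polytope_leb_fin (mesh_cell i).1. Qed.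

Lemma mesh_wf_face (f : 'I_(nfaces M)) : wf_face Omega f.
Proof. by have [_ _ _ h _] := hM. Qed.

Lemma mesh_fdom (f : 'I_(nfaces M)) : open_polytope (fdom f).
Proof. by have [] := mesh_wf_face f. Qed.

Lemma mesh_fdom_measurable (f : 'I_(nfaces M)) : measurable (fdom f).
Proof. exact: open_polytope_measurable (mesh_fdom f). Qed.

Lemma mesh_fdom_finite (f : 'I_(nfaces M)) : (leb R n (fdom f) < +oo)%E.
Proof. exact: open_polytope_leb_fin (mesh_fdom f). Qed.

(** Otherwise the normal and its opposite would both point out of the same cell. *)
Lemma mesh_inner_neq_outer (f : 'I_(nfaces M)) : outer f != Some (inner f).
Proof.
apply/eqP => oE; have [[[y Dy] _] _ [_ out1]] := mesh_wf_face f.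
rewrite oE => -[_ _ out2].
have fz : face f (fpar f y) by exists y.
have [r r0 hr] := out1 _ fz; have [r' r'0 hr'] := out2 _ fz.
pose s := Num.min r r' / 2.
have s0 : 0 < s by rewrite divr_gt0// lt_min r0.
have [sr sr'] : s < r /\ s < r'.
  have : Num.min r r' <= r by rewrite ge_min lexx.
  have : Num.min r r' <= r' by rewrite ge_min lexx orbT.
  by rewrite /s; move=> ? ?; split; lra.
have [|_ nK] := hr s; first by rewrite s0.
have [|K' _] := hr' s; first by rewrite s0.
by apply: nK; move: K'; rewrite scalerN opprK.
Qed.

Definition mesh_outnormal (i : 'I_(ncells M)) (f : 'I_(nfaces M)) : 'rV[R]_n.+1 :=
  if inner f == i then fnormal f else - fnormal f.

Lemma mesh_balance (i : 'I_(ncells M)) :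
  \sum_(f | face_of i f) fine (leb R n (fdom f)) *: mesh_outnormal i f = 0.
Proof.
have [_ _ _ _ /(_ i)[bd dis]] := hM.
apply: (@faces_balance R n 'I_(nfaces M) (face_of i) (cell i) (@fdom R _ M) (@fbase R _ M)
  (@fframe R _ M) (mesh_outnormal i)) => //.
- exact: open_polytope_open (mesh_cell i).1.
- exact: open_polytope_bounded (mesh_cell i).1.
- by move=> f _; exact: mesh_fdom.
- move=> f _; have [_ [h1 h2 h3] _ _] := mesh_wf_face f.
  rewrite /mesh_outnormal; case: ifP => _ //; split => //.
    by rewrite linearN /= mulmxN h2 oppr0.
  by rewrite dotNr dotNl opprK.
- move=> f /orP; have [_ _ [_ out1]] := mesh_wf_face f => out2.
  rewrite /mesh_outnormal; case: eqVneq => [<- _|_ [//|/eqP oE]].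
    exact: out1.
  by move: out2; rewrite oE => -[].
Qed.

(** The integral of the balance of areas and normals against the vector field [w]. *)
Lemma mesh_net_flux d (T : measurableType d) (mu : {measure set T -> \bar R})
    (B : set T) (w : T -> 'rV[R]_n.+1) (i : 'I_(ncells M)) :
  measurable B ->
  (forall f, face_of i f -> mu.-integrable B (fun x => (dot (fnormal f) (w x))%:E)) ->
  \sum_(f | face_of i f) fine (leb R n (fdom f)) *
    Rintegral mu B (fun x => dot (mesh_outnormal i f) (w x)) = 0.
Proof.
move=> mB fint.
have oint f : face_of i f -> mu.-integrable B (fun x => (dot (mesh_outnormal i f) (w x))%:E).
  move=> fi; rewrite /mesh_outnormal; case: ifP => _; first exact: fint.
  have := integrableN (fint f fi).
  by apply: eq_integrable => // x _; rewrite /= dotNl.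
transitivity (\sum_(f | face_of i f)
    Rintegral mu B (fun x => fine (leb R n (fdom f)) * dot (mesh_outnormal i f) (w x))).
  by apply: eq_bigr => f fi; rewrite RintegralZl//; exact: oint.
rewrite -Rintegral_sum//; last first.
  move=> f fi; have := integrableZl mB (fine (leb R n (fdom f))) (oint f fi).
  by apply: eq_integrable => // x _; rewrite /= EFinM.
rewrite (@eq_Rintegral _ _ _ _ _ (cst 0)); first by rewrite Rintegral_cst// mul0r.
move=> x _ /=.
transitivity (dot (\sum_(f | face_of i f) fine (leb R n (fdom f)) *: mesh_outnormal i f) (w x)).
  by rewrite dotC dot_sum; apply: eq_bigr => f _; rewrite dotZr dotC.
by rewrite mesh_balance dotC dotE big1// => j _; rewrite mxE mul0r.
Qed.

End mesh_cells.

Section product_faces.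
Context (R : realType) (n : nat) (Omegax Omegav : set 'rV[R]_n.+1).
Context (Mx Mv : mesh R n.+1) (hMx : is_mesh Omegax Mx) (hMv : is_mesh Omegav Mv).
Implicit Types (e : pface Mx Mv) (h : phase R n.+1 -> R).

Let mX (f : 'I_(nfaces Mx)) (j : 'I_(ncells Mv)) : measurable (fdom f `*` cell j).
Proof.
by apply: measurableX; [exact: (mesh_fdom_measurable hMx)|exact: (mesh_cell_measurable hMv)].
Qed.

Let mV (i : 'I_(ncells Mx)) (f : 'I_(nfaces Mv)) : measurable (cell i `*` fdom f).
Proof.
by apply: measurableX; [exact: (mesh_cell_measurable hMx)|exact: (mesh_fdom_measurable hMv)].
Qed.

Let finX (f : 'I_(nfaces Mx)) (j : 'I_(ncells Mv)) :
  ((leb R n \x leb R n.+1) (fdom f `*` cell j) < +oo)%E.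
Proof.
rewrite product_measure1E; [|exact: (mesh_fdom_measurable hMx)|exact: (mesh_cell_measurable hMv)].
apply: lte_mul_pinfty => //; last exact: (mesh_cell_finite hMv).
by rewrite ge0_fin_numE//; exact: (mesh_fdom_finite hMx).
Qed.

Let finV (i : 'I_(ncells Mx)) (f : 'I_(nfaces Mv)) :
  ((leb R n.+1 \x leb R n) (cell i `*` fdom f) < +oo)%E.
Proof.
rewrite product_measure1E; [|exact: (mesh_cell_measurable hMx)|exact: (mesh_fdom_measurable hMv)].
apply: lte_mul_pinfty => //; last exact: (mesh_fdom_finite hMv).
by rewrite ge0_fin_numE//; exact: (mesh_cell_finite hMx).
Qed.

Lemma face_intD e h1 h2 : face_integrable e h1 -> face_integrable e h2 ->
  face_int e (fun z => h1 z + h2 z) = face_int e h1 + face_int e h2.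
Proof.
case: e => [[f j]|[i f]] /= i1 i2.
  by rewrite RintegralD//; exact: mX.
by rewrite RintegralD//; exact: mV.
Qed.

Lemma face_intZl e c h : face_integrable e h ->
  face_int e (fun z => c * h z) = c * face_int e h.
Proof.
case: e => [[f j]|[i f]] /= i1.
  by rewrite RintegralZl//; exact: mX.
by rewrite RintegralZl//; exact: mV.
Qed.

Lemma face_integrableD e h1 h2 : face_integrable e h1 -> face_integrable e h2 ->
  face_integrable e (fun z => h1 z + h2 z).
Proof.
case: e => [[f j]|[i f]] /= i1 i2.
  by apply: eq_integrable (integrableD (mX f j) i1 i2) => [|p _]; rewrite ?EFinD//; exact: mX.
by apply: eq_integrable (integrableD (mV i f) i1 i2) => [|p _]; rewrite ?EFinD//; exact: mV.
Qed.

Lemma face_integrableZl e c h : face_integrable e h ->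
  face_integrable e (fun z => c * h z).
Proof.
case: e => [[f j]|[i f]] /= i1.
  by apply: eq_integrable (integrableZl (mX f j) c i1) => [|p _]; rewrite ?EFinM//; exact: mX.
by apply: eq_integrable (integrableZl (mV i f) c i1) => [|p _]; rewrite ?EFinM//; exact: mV.
Qed.

Lemma eq_face_int e h1 h2 : (forall z, pface_set e z -> h1 z = h2 z) ->
  face_int e h1 = face_int e h2.
Proof.
case: e => [[f j]|[i f]] /= h12; apply: eq_Rintegral => -[a b]; rewrite inE => -[/= ha hb];
  apply: h12; split => //=; [by exists a|by exists b].
Qed.

Lemma face_int_ge0 e h : (forall z, pface_set e z -> 0 <= h z) -> 0 <= face_int e h.
Proof.
case: e => [[f j]|[i f]] /= h0; apply: Rintegral_ge0 => -[a b] [/= ha hb];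
  apply: h0; split => //=; [by exists a|by exists b].
Qed.

Lemma face_integrable_cst e c : face_integrable e (cst c).
Proof.
case: e => [[f j]|[i f]] /=.
  by apply: (@bounded_integrable _ _ _ _ _ (cst c) `|c| (mX f j) (finX f j));
    [exact: measurable_cst|move=> ? _ /=].
by apply: (@bounded_integrable _ _ _ _ _ (cst c) `|c| (mV i f) (finV i f));
  [exact: measurable_cst|move=> ? _ /=].
Qed.

Lemma pdot_x (m : 'rV[R]_n.+1) (z : phase R n.+1) : pdot (m, 0) z = dot m z.1.
Proof. by rewrite /pdot dot0l addr0. Qed.

Lemma pdot_v (m : 'rV[R]_n.+1) (z : phase R n.+1) : pdot (0, m) z = dot m z.2.
Proof. by rewrite /pdot dot0l add0r. Qed.

Lemma pdotN (m z : phase R n.+1) : pdot (- m) z = - pdot m z.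
Proof. by rewrite /pdot !dotNl opprD. Qed.

Section velocity_flux.
Context (E : R -> 'rV[R]_n.+1 -> 'rV[R]_n.+1) (t C : R).
Hypothesis mE : forall k, measurable_fun Omegax (fun x => E t x ord0 k).
Hypothesis mO : measurable Omegax.
Local Notation na e z := (pdot (pnormal e) (velocity E t z)).
Hypothesis naC : forall e z, pface_set e z -> `|na e z| <= C.

Let mEdot (i : 'I_(ncells Mx)) (m : 'rV[R]_n.+1) :
  measurable_fun (cell i) (fun x => dot m (- E t x)).
Proof.
under eq_fun do rewrite dotE.
apply: measurable_sum => k; apply: measurable_funM; last exact: measurable_cst.
under eq_fun do rewrite mxE.
apply: measurableT_comp => //; apply: measurable_funS (mE k) => //.
exact: (mesh_cell hMx i).2.
Qed.

Lemma measurable_face_normal (f : 'I_(nfaces Mx)) (j : 'I_(ncells Mv)) :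
  measurable_fun (fdom f `*` cell j)
  (fun p : 'rV[R]_n * 'rV[R]_n.+1 => na (inl (f, j) : pface Mx Mv) (fpar f p.1, p.2)).
Proof.
apply: measurable_funTS; under eq_fun do rewrite pdot_x /=.
exact: (measurableT_comp (measurable_dot _) measurable_snd).
Qed.

Lemma measurable_face_normal_v (i : 'I_(ncells Mx)) (f : 'I_(nfaces Mv)) :
  measurable_fun (cell i `*` fdom f)
  (fun p : 'rV[R]_n.+1 * 'rV[R]_n => na (inr (i, f) : pface Mx Mv) (p.1, fpar f p.2)).
Proof.
under eq_fun do rewrite pdot_v /=.
apply: (@measurable_comp _ _ _ _ _ _ (cell i) (fun x => dot (fnormal f) (- E t x)) _ fst).
- exact: (mesh_cell_measurable hMx).
- by move=> _ [p [cp _] <-].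
- exact: mEdot.
- exact: measurable_funTS measurable_fst.
Qed.

Lemma face_integrable_normal e : face_integrable e (fun z => na e z).
Proof.
move: (@naC e); case: e => [[f j]|[i f]] /= eC.
  apply: (@bounded_integrable _ _ _ _ _ _ C (mX f j) (finX f j)).
    exact: measurable_face_normal.
  by move=> [y v] [/= Dy cv]; apply: eC; split => //; exists y.
apply: (@bounded_integrable _ _ _ _ _ _ C (mV i f) (finV i f)).
  exact: measurable_face_normal_v.
by move=> [x y] [/= cx Dy]; apply: eC; split => //; exists y.
Qed.

Lemma face_integrable_abs_normal e : face_integrable e (fun z => `|na e z|).
Proof.
move: (@naC e); case: e => [[f j]|[i f]] /= eC.
  apply: (@bounded_integrable _ _ _ _ _ _ C (mX f j) (finX f j)).
    by apply: measurableT_comp => //; exact: measurable_face_normal.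
  by move=> [y v] [/= Dy cv]; rewrite normr_id; apply: eC; split => //; exists y.
apply: (@bounded_integrable _ _ _ _ _ _ C (mV i f) (finV i f)).
  by apply: measurableT_comp => //; exact: measurable_face_normal_v.
by move=> [x y] [/= cx Dy]; rewrite normr_id; apply: eC; split => //; exists y.
Qed.

Lemma face_integrable_outnormal (K : pcell Mx Mv) e :
  face_integrable e (fun z => pdot (outnormal K e) (velocity E t z)).
Proof.
rewrite /outnormal; case: ifP => _; first exact: face_integrable_normal.
have := face_integrableZl (-1) (face_integrable_normal e).
by congr face_integrable; apply/funext => z; rewrite mulN1r pdotN.
Qed.

Let int_x f (j : 'I_(ncells Mv)) :
  (leb R n.+1).-integrable (cell j) (fun v => (dot (fnormal (m:=Mx) f) v)%:E).
Proof.
have [[y Dy] _] := mesh_fdom hMx f.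
apply: (@bounded_integrable _ _ _ _ _ _ C (mesh_cell_measurable hMv j) (mesh_cell_finite hMv j)).
  exact: measurable_funTS (measurable_dot _).
move=> v cv; have := @naC (inl (f, j)) (fpar f y, v); rewrite pdot_x /=; apply.
by split => //; exists y.
Qed.

Let int_v (i : 'I_(ncells Mx)) f :
  (leb R n.+1).-integrable (cell i) (fun x => (dot (fnormal (m:=Mv) f) (- E t x))%:E).
Proof.
have [[y Dy] _] := mesh_fdom hMv f.
apply: (@bounded_integrable _ _ _ _ _ _ C (mesh_cell_measurable hMx i) (mesh_cell_finite hMx i)).
  exact: mEdot.
move=> x cx; have := @naC (inr (i, f)) (x, fpar f y); rewrite pdot_v /=; apply.
by split => //; exists y.
Qed.

Let int_outnormal d (T : measurableType d) (mu : {measure set T -> \bar R}) (D : set T)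
    (w : T -> 'rV[R]_n.+1) (M : mesh R n.+1) i (f : 'I_(nfaces M)) :
  measurable D -> mu.-integrable D (fun x => (dot (fnormal f) (w x))%:E) ->
  mu.-integrable D (EFin \o (fun x => dot (mesh_outnormal i f) (w x))).
Proof.
move=> mD fi; rewrite /mesh_outnormal; case: ifP => _ //.
by have := integrableN fi; apply: eq_integrable => // x _; rewrite /= dotNl.
Qed.

Let int_one (M : mesh R n.+1) Omega (hM : is_mesh Omega M) (f : 'I_(nfaces M)) :
  (leb R n).-integrable (fdom f) (EFin \o cst 1).
Proof.
apply: (@bounded_integrable _ _ _ _ _ _ 1 (mesh_fdom_measurable hM f) (mesh_fdom_finite hM f)).
  exact: measurable_cst.
by move=> x _; rewrite normr1.
Qed.

Lemma outnormal_x i j f : outnormal (i, j) (inl (f, j) : pface Mx Mv) = (mesh_outnormal i f, 0).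
Proof.
rewrite /outnormal /mesh_outnormal /= xpair_eqE eqxx andbT; case: ifP => // _.
by have -> : - (fnormal f, 0) = (- fnormal f, - 0) :> phase R n.+1 by []; rewrite oppr0.
Qed.

Lemma outnormal_v i j f : outnormal (i, j) (inr (i, f) : pface Mx Mv) = (0, mesh_outnormal j f).
Proof.
rewrite /outnormal /mesh_outnormal /= xpair_eqE eqxx /=; case: ifP => // _.
by have -> : - (0, fnormal f) = (- 0, - fnormal f) :> phase R n.+1 by []; rewrite oppr0.
Qed.

Lemma pface_of_x i j f j' :
  pface_of (i, j) (inl (f, j') : pface Mx Mv) = face_of i f && (j' == j).
Proof.
rewrite /pface_of /face_of /= xpair_eqE andb_orl; congr orb.
by case: (outer f) => //= i'; rewrite (inj_eq Some_inj) (inj_eq Some_inj) xpair_eqE.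
Qed.

Lemma pface_of_v i j i' f :
  pface_of (i, j) (inr (i', f) : pface Mx Mv) = (i' == i) && face_of j f.
Proof.
rewrite /pface_of /face_of /= xpair_eqE andb_orr; congr orb.
case: (outer f) => [j'|] /=; last by rewrite andbF.
by rewrite (inj_eq Some_inj) (inj_eq Some_inj) xpair_eqE.
Qed.

Lemma face_int_outnormal_x i j f : face_of i f ->
  face_int (inl (f, j) : pface Mx Mv)
    (fun z => pdot (outnormal (i, j) (inl (f, j) : pface Mx Mv)) (velocity E t z)) =
  fine (leb R n (fdom f)) *
    Rintegral (leb R n.+1) (cell j) (fun v => dot (mesh_outnormal i f) v).
Proof.
move=> fi; rewrite outnormal_x /=; under eq_Rintegral do rewrite pdot_x /= -[dot _ _]mul1r.
have mA := mesh_fdom_measurable hMx f; have mB := mesh_cell_measurable hMv j.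
have := face_integrable_outnormal (i, j) (inl (f, j)); rewrite outnormal_x /= => hint.
rewrite (@Rintegral_prod _ _ _ _ _ (leb R n) (leb R n.+1) _ _ (cst 1)) => //.
- by rewrite Rintegral_cst// mul1r.
- exact: int_one hMx f.
- exact: int_outnormal (int_x f j).
- apply: eq_integrable hint => [|p _]; first exact: mX.
  by rewrite pdot_x /= mul1r.
Qed.

Lemma face_int_outnormal_v i j f : face_of j f ->
  face_int (inr (i, f) : pface Mx Mv)
    (fun z => pdot (outnormal (i, j) (inr (i, f) : pface Mx Mv)) (velocity E t z)) =
  fine (leb R n (fdom f)) *
    Rintegral (leb R n.+1) (cell i) (fun x => dot (mesh_outnormal j f) (- E t x)).
Proof.
move=> fj; rewrite outnormal_v /=; under eq_Rintegral do rewrite pdot_v /= -[dot _ _]mulr1.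
have mA := mesh_fdom_measurable hMv f; have mB := mesh_cell_measurable hMx i.
have := face_integrable_outnormal (i, j) (inr (i, f)); rewrite outnormal_v /= => hint.
rewrite (@Rintegral_prod _ _ _ _ _ (leb R n.+1) (leb R n) _ _
  (fun x => dot (mesh_outnormal j f) (- E t x)) (cst 1)) => //.
- by rewrite Rintegral_cst// mul1r mulrC.
- exact: int_outnormal (int_v i f).
- exact: int_one hMv f.
- apply: eq_integrable hint => [|p _]; first exact: mV.
  by rewrite pdot_v /= mulr1.
Qed.

(** On a spatial face the normal velocity depends on the velocity variable only,
    and conversely, so the total flux through the boundary of a product cell is a
    sum of areas times normals of the faces of one factor, against a vector
    integrated over the other factor. *)
Lemma net_flux (K : pcell Mx Mv) :
  \sum_(e | pface_of K e) face_int e (fun z => pdot (outnormal K e) (velocity E t z)) = 0.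
Proof.
case: K => i j.
pose G e := face_int e (fun z => pdot (outnormal (i, j) e) (velocity E t z)).
have Gx : \sum_(p | pface_of (i, j) (inl p : pface Mx Mv)) G (inl p) = 0.
  rewrite (eq_bigl (fun p => face_of i p.1 && (p.2 == j))); last first.
    by move=> [f j']; rewrite pface_of_x.
  rewrite (eq_bigr (fun p => G (inl (p.1, p.2)))); last by case.
  rewrite -(pair_big (face_of i) (fun j' => j' == j) (fun f j' => G (inl (f, j')))).
  rewrite (eq_bigr (fun f : 'I_(nfaces Mx) => fine (leb R n (fdom f)) *
      Rintegral (leb R n.+1) (cell j) (fun v => dot (mesh_outnormal i f) v))).
    apply: (mesh_net_flux hMx (w := id)); first exact: (mesh_cell_measurable hMv).
    by move=> f _; exact: int_x.
  by move=> f fi; rewrite big_pred1_eq; exact: face_int_outnormal_x.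
suff Gv : \sum_(p | pface_of (i, j) (inr p : pface Mx Mv)) G (inr p) = 0.
  transitivity (\sum_(p | pface_of (i, j) (inl p : pface Mx Mv)) G (inl p) +
      \sum_(p | pface_of (i, j) (inr p : pface Mx Mv)) G (inr p)).
    exact: big_sumType.
  by rewrite Gx Gv addr0.
rewrite (eq_bigl (fun p => (p.1 == i) && face_of j p.2)); last first.
  by move=> [i' f]; rewrite pface_of_v.
rewrite (eq_bigr (fun p => G (inr (p.1, p.2)))); last by case.
rewrite -(pair_big (fun i' => i' == i) (face_of j) (fun i' f => G (inr (i', f)))).
rewrite big_pred1_eq.
rewrite (eq_bigr (fun f : 'I_(nfaces Mv) => fine (leb R n (fdom f)) *
    Rintegral (leb R n.+1) (cell i) (fun x => dot (mesh_outnormal j f) (- E t x)))).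
  apply: (mesh_net_flux hMv (w := fun x => - E t x)); first exact: (mesh_cell_measurable hMx).
  by move=> f _; exact: int_v.
by move=> f fj; exact: face_int_outnormal_v.
Qed.

End velocity_flux.

End product_faces.

(** * Stability of the forward Euler step *)

Section euler_step.
Context (R : realType) (n : nat) (Omegax Omegav : set 'rV[R]_n.+1).
Context (Mx Mv : mesh R n.+1) (hMx : is_mesh Omegax Mx) (hMv : is_mesh Omegav Mv).
Context (E : R -> 'rV[R]_n.+1 -> 'rV[R]_n.+1) (g : R -> phase R n.+1 -> R) (t C : R).
Context (kind : pface Mx Mv -> flux_kind) (lloc : R -> pface Mx Mv -> R) (lglob : R -> R).
Implicit Types (e : pface Mx Mv) (K : pcell Mx Mv).
Local Notation alpha := (dissipation E kind lloc lglob).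
Local Notation na e z := (pdot (pnormal e) (velocity E t z)).
Local Notation out K e z := (pdot (outnormal K e) (velocity E t z)).
Hypothesis mE : forall k, measurable_fun Omegax (fun x => E t x ord0 k).
Hypothesis mO : measurable Omegax.
Hypothesis boundary_upwind : forall e, pouter e = None -> kind e = Upwind.
Hypothesis na_alpha : forall e z, pface_set e z -> `|na e z| <= alpha t e z.
Hypothesis alphaC : forall e z, pface_set e z -> alpha t e z <= C.
Hypothesis g_integrable : forall e, pouter e = None ->
  face_integrable e (fun z => Num.min (na e z) 0 * inflow_value g t e z).

Let naC e z : pface_set e z -> `|na e z| <= C.
Proof. by move=> ez; apply: le_trans (na_alpha ez) (alphaC ez). Qed.

Let int_alpha e : face_integrable e (fun z => alpha t e z).
Proof.
rewrite /dissipation; case: (kind e); last 2 first.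
- exact: (face_integrable_cst hMx hMv).
- exact: (face_integrable_cst hMx hMv).
exact (face_integrable_abs_normal hMx hMv mE mO (@naC) e).
Qed.

Let int_out K e : face_integrable e (fun z => out K e z).
Proof. exact (face_integrable_outnormal hMx hMv mE mO (@naC) K e). Qed.

(** Splitting the flux by upwinding: [outflow] multiplies the value inside the
    cell, [inflow] the value on the other side. *)
Definition outflow K e : R := face_int e (fun z => 2^-1 * (alpha t e z + out K e z)).
Definition inflow K e : R := face_int e (fun z => 2^-1 * (alpha t e z + (-1) * out K e z)).

Let int_outflow K e : face_integrable e (fun z => 2^-1 * (alpha t e z + out K e z)).
Proof. by apply: (face_integrableZl hMx hMv) => //; apply: (face_integrableD hMx hMv). Qed.

Let int_inflow K e : face_integrable e (fun z => 2^-1 * (alpha t e z + (-1) * out K e z)).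
Proof.
apply: (face_integrableZl hMx hMv) => //; apply: (face_integrableD hMx hMv) => //.
exact: (face_integrableZl hMx hMv).
Qed.

Let out_alpha K e z : pface_set e z -> `|out K e z| <= alpha t e z.
Proof.
move=> /na_alpha h; rewrite /outnormal; case: ifP => // _.
by rewrite pdotN normrN.
Qed.

Lemma outflow_ge0 K e : 0 <= outflow K e.
Proof.
apply: face_int_ge0 => z ez; have := out_alpha K ez; rewrite ler_norml => /andP[h _].
by rewrite mulr_ge0//; lra.
Qed.

Lemma inflow_ge0 K e : 0 <= inflow K e.
Proof.
apply: face_int_ge0 => z ez; have := out_alpha K ez; rewrite ler_norml => /andP[_ h].
by rewrite mulr_ge0//; lra.
Qed.

(** The contributions of the normal velocity cancel by [net_flux]. *)
Lemma sum_outflow K :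
  \sum_(e | pface_of K e) outflow K e = 2^-1 * \sum_(e | pface_of K e) face_int e (alpha t e).
Proof.
have nf := net_flux hMx hMv mE mO (@naC) K.
rewrite -[X in _ * X]addr0 -[X in _ + X]nf -big_split /= mulr_sumr.
apply: eq_bigr => e _.
rewrite /outflow (face_intZl hMx hMv); last exact: (face_integrableD hMx hMv).
by congr (_ * _); exact: (face_intD hMx hMv (int_alpha e) (int_out K e)).
Qed.

Lemma sum_inflow K :
  \sum_(e | pface_of K e) inflow K e = 2^-1 * \sum_(e | pface_of K e) face_int e (alpha t e).
Proof.
have nf := net_flux hMx hMv mE mO (@naC) K.
rewrite -[X in _ * X]addr0 -[X in _ + X](mulr0 (-1)) -[X in _ + _ * X]nf.
rewrite (mulr_sumr _ _ _ (-1)) -big_split /= mulr_sumr.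
apply: eq_bigr => e _; have i1 := face_integrableZl hMx hMv (-1) (int_out K e).
rewrite /inflow (face_intZl hMx hMv); last exact: (face_integrableD hMx hMv).
rewrite (face_intD hMx hMv (int_alpha e) i1).
by rewrite (face_intZl hMx hMv _ (int_out K e)).
Qed.

(** What enters a cell through a face leaves the cell on the other side. *)
Lemma inflow_le_outflow (f : pcell Mx Mv -> R) : (forall K, 0 <= f K) ->
  \sum_K \sum_(e | pface_of K e) inflow K e * oapp f 0 (neighbour K e) <=
  \sum_K \sum_(e | pface_of K e) outflow K e * f K.
Proof.
move=> f0; rewrite (exchange_big_dep xpredT) //= [leRHS](exchange_big_dep xpredT) //=.
apply: ler_sum => e _; rewrite /pface_of /neighbour.
set K1 := pinner e.
have fluxN K2 : K2 != K1 -> inflow K1 e = outflow K2 e /\ inflow K2 e = outflow K1 e.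
  move=> K21; split; apply: eq_face_int => z _; rewrite /outnormal -/K1 eqxx.
    by rewrite [K1 == K2]eq_sym (negbTE K21) pdotN; ring.
  by rewrite [K1 == K2]eq_sym (negbTE K21) pdotN; ring.
case eo : (pouter e) => [K2|]; last first.
  have only1 (G : pcell Mx Mv -> R) :
      \sum_(K | (K1 == K) || (None == Some K)) G K = G K1.
    by apply: big_pred1 => K; rewrite orbF eq_sym.
  by rewrite !only1 eqxx /= mulr0 mulr_ge0// outflow_ge0.
have K21 : K2 != K1.
  apply/eqP => K21; move: eo; rewrite K21 /K1.
  case: (e) => [[fc j]|[i fc]] /=; case eof: (outer fc) => [k|] //= -[kE].
    by have := mesh_inner_neq_outer hMx fc; rewrite eof kE eqxx.
  by have := mesh_inner_neq_outer hMv fc; rewrite eof kE eqxx.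
have split2 (G : pcell Mx Mv -> R) :
    \sum_(K | (K1 == K) || (Some K2 == Some K)) G K = G K1 + G K2.
  rewrite (bigD1 K1) ?eqxx//=; congr (_ + _); apply: big_pred1 => K.
  rewrite (inj_eq Some_inj) /=; have [<-|K1K] := eqVneq K1 K.
    by rewrite /= [K1 == K2]eq_sym (negbTE K21) ?eqxx.
  by rewrite andbT eq_sym.
have [e1 e2] := fluxN _ K21.
rewrite !split2 !eqxx [K1 == K2]eq_sym (negbTE K21) /= e1 e2 addrC.
exact: lexx.
Qed.

Lemma upwind_splitting (a b u v : R) :
  a * ((u + v) / 2) + b / 2 * (u - v) =
  u * (2^-1 * (b + a)) + - v * (2^-1 * (b + -1 * a)).
Proof. by field. Qed.

(** With the upwind dissipation the exterior value is multiplied by the negative part of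
    the normal velocity only, which is the product assumed integrable for the data. *)
Lemma upwind_boundary (a u v : R) :
  a * ((u + v) / 2) + `|a| / 2 * (u - v) =
  u * (2^-1 * (`|a| + a)) + Num.min a 0 * v.
Proof.
by have [a0|a0] := ltrP a 0; [rewrite ltr0_norm//; field|rewrite ger0_norm//; field].
Qed.

(** The last summand, from the inflow data, does not depend on the state [U] and
    disappears from the difference of two states. *)
Lemma face_int_flux (U : 'M[R]_(ncells Mx, ncells Mv)) K e : pface_of K e ->
  face_int e (fun z => num_flux (velocity E t z) (outnormal K e) (alpha t e z)
    (uval U K) (uplus g U t K e z)) =
  outflow K e * uval U K - inflow K e * oapp (uval U) 0 (neighbour K e) +
  (if neighbour K e is Some _ then 0 else
     face_int e (fun z => Num.min (na e z) 0 * inflow_value g t e z)).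
Proof.
move=> Ke; rewrite /uplus; case eN : (neighbour K e) => [K'|] /=.
  rewrite addr0 -mulrN ![_ * uval _ _]mulrC [_ * (- _)]mulrC.
  rewrite /outflow /inflow -!(face_intZl hMx hMv)// -(face_intD hMx hMv); last 2 first.
  - exact: (face_integrableZl hMx hMv).
  - exact: (face_integrableZl hMx hMv).
  by apply: eq_face_int => z _; rewrite /num_flux upwind_splitting.
have [eK eo] : pinner e = K /\ pouter e = None.
  by move: eN; rewrite /neighbour; case: eqP.
rewrite mulr0 subr0 mulrC /outflow -(face_intZl hMx hMv)// -(face_intD hMx hMv); last 2 first.
- exact: (face_integrableZl hMx hMv).
- exact: g_integrable.
apply: eq_face_int => z _; rewrite /num_flux /dissipation boundary_upwind//.
by rewrite /outnormal eK eqxx upwind_boundary.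
Qed.

(** The difference of the two updates is the update of the difference without inflow
    data, to which [update_contraction] applies. *)
Lemma euler_contraction (tau : R) (U V : 'M[R]_(ncells Mx, ncells Mv)) :
  0 <= tau ->
  (forall K, vol K != 0 ->
    tau * (2^-1 * \sum_(e | pface_of K e) face_int e (alpha t e)) <= vol K) ->
  frob ((U + tau *: Fh E alpha g t U) - (V + tau *: Fh E alpha g t V)) <= frob (U - V).
Proof.
move=> tau0 cfl; rewrite frob_leP !fdotE !pair_bigA /=.
pose D K := U K.1 K.2 - V K.1 K.2.
pose u K := uval U K - uval V K.
have vol0 K : 0 <= vol K by apply: fine_ge0; exact: measure_ge0.
have uE K : u K = D K / Num.sqrt (vol K) by rewrite /u /uval -mulrBl.
have := update_contraction tau0 vol0 (fun K e _ => inflow_ge0 K e)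
  sum_outflow sum_inflow cfl inflow_le_outflow uE.
suff stepE K : (U + tau *: Fh E alpha g t U - (V + tau *: Fh E alpha g t V)) K.1 K.2 =
    D K - tau * ((Num.sqrt (vol K))^-1 * \sum_(e | pface_of K e)
      (outflow K e * u K - inflow K e * oapp u 0 (neighbour K e))).
  move=> h; apply: (@le_trans _ _ (\sum_K D K ^+ 2)).
    by apply: le_trans h; apply: ler_sum => K _; rewrite stepE expr2.
  by apply: ler_sum => K _; rewrite /D !mxE expr2.
pose flux W := \sum_(e | pface_of K e) face_int e (fun z => num_flux (velocity E t z)
  (outnormal K e) (alpha t e z) (uval W K) (uplus g W t K e z)).
have fluxB : \sum_(e | pface_of K e)
    (outflow K e * u K - inflow K e * oapp u 0 (neighbour K e)) = flux U - flux V.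
  rewrite /flux -sumrB; apply: eq_bigr => e Ke; rewrite !face_int_flux// /u.
  move: (outflow K e) (inflow K e) (uval U K) (uval V K) => a b x y.
  case: (neighbour K e) => [K'|] /=.
    move: (uval U K') (uval V K') => x' y'; ring.
  move: (face_int _ _) => c; ring.
have FE W : Fh E alpha g t W K.1 K.2 = - (Num.sqrt (vol K))^-1 * flux W.
  by case: (K) @flux {fluxB} => i j flux; rewrite mxE.
have entry (P P' W W' : 'M[R]_(ncells Mx, ncells Mv)) i j :
    (P + tau *: W - (P' + tau *: W')) i j = P i j + tau * W i j - (P' i j + tau * W' i j).
  by rewrite !mxE.
rewrite fluxB entry !FE /D.
move: (flux U) (flux V) (U K.1 K.2) (V K.1 K.2) (Num.sqrt _)^-1 => a b x y s; ring.
Qed.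

End euler_step.

(** An infinite supremum of the rates would force [tau <= 0]; if the supremum is 0, all
    rates vanish and the bound is trivial. *)
Lemma tau_CFL_bound (R : realType) (d : nat) (Mx Mv : mesh R d)
    (alpha : R -> pface Mx Mv -> phase R d -> R) (T t tau : R) (K : pcell Mx Mv) :
  0 < tau -> (tau%:E <= tau_CFL alpha T)%E -> 0 <= t <= T ->
  vol K != 0 -> 0 <= \sum_(e | pface_of K e) face_int e (alpha t e) ->
  tau * (2^-1 * \sum_(e | pface_of K e) face_int e (alpha t e)) <= vol K.
Proof.
move=> tau0; rewrite /tau_CFL; set S := [set y | _] => hCFL tT volK.
set s := \sum_(e | _) _ => s0.
have vpos : 0 < vol K by rewrite lt_def volK fine_ge0.
have hK : ((cfl_rate alpha t K)%:E <= ereal_sup S)%E.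
  by apply: ereal_sup_ubound; exists t, K.
have rateE : cfl_rate alpha t K = (2 * vol K)^-1 * s by [].
have rate0 : 0 <= cfl_rate alpha t K.
  by rewrite rateE mulr_ge0// invr_ge0 mulr_ge0// ltW.
have sE : 2^-1 * s = cfl_rate alpha t K * vol K.
  by rewrite rateE invfM -!mulrA [_^-1 * (s * _)]mulrCA mulVf// mulr1.
rewrite sE mulrA ger_pMl//.
case: (ereal_sup S) hCFL hK => [q| |] /=.
- rewrite inver lee_fin; have [-> _ r0|q0] := eqVneq q 0.
    have -> : cfl_rate alpha t K = 0 by apply/eqP; rewrite eq_le r0.
    by rewrite mulr0.
  rewrite lee_fin => tq rq.
  have qpos : 0 < q by rewrite lt_def q0 (le_trans rate0 rq).
  apply: (@le_trans _ _ (q^-1 * q)); last by rewrite mulVf.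
  by apply: ler_pM => //; exact: ltW.
- by rewrite invey lee_fin leNgt tau0.
- by [].
Qed.

Theorem theorem4p3 (R : realType) (d : nat) (hd : (1 <= d)%N)
  (T : R) (hT : 0 < T)
  (Omegax Omegav : set 'rV[R]_d)
  (hOmegax : pl_domain Omegax) (hOmegav : open_polytope Omegav)
  (E : R -> 'rV[R]_d -> 'rV[R]_d) (hE : C_W1oo T Omegax E)
  (Mx Mv : mesh R d) (hMx : is_mesh Omegax Mx) (hMv : is_mesh Omegav Mv)
  (ng : nat) (gx gv : 'I_ng -> R -> 'rV[R]_d -> R)
  (hg : inflow_integrable Mx Mv E (separated_inflow gx gv) T)
  (kind : pface Mx Mv -> flux_kind)
  (lloc : R -> pface Mx Mv -> R) (lglob : R -> R)
  (hflux : admissible_flux E T kind lloc lglob)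
  (hbound : exists C : R, forall t e z, 0 <= t <= T -> pface_set e z ->
     `|dissipation E kind lloc lglob t e z| <= C)
  (eps1 eps2 : R) (heps1 : 0 <= eps1) (heps2 : 0 <= eps2)
  (NT : nat) (tau : R) (htau : tau = T / NT%:R) (htau0 : 0 < tau)
  (hCFL : (tau%:E <= tau_CFL (dissipation E kind lloc lglob) T)%E)
  (U : nat -> factored R (ncells Mx) (ncells Mv))
  (hU0 : svd_form (U 0%N))
  (hU : forall n : nat, (n < NT)%N ->
     SAT_step
       (Fh E (dissipation E kind lloc lglob) (separated_inflow gx gv) (n%:R * tau))
       tau eps1 eps2 (U n) (U n.+1))
  (Uhat : nat -> 'M[R]_(ncells Mx, ncells Mv))
  (hUhat : forall n : nat, (n < NT)%N ->
     Uhat n.+1 = Uhat n + tau *: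
       Fh E (dissipation E kind lloc lglob) (separated_inflow gx gv) (n%:R * tau)
         (Uhat n))
  (delta : R) (hdelta : 0 <= delta)
  (h0 : frob (fval (U 0%N) - Uhat 0%N) <= delta)
  (n : nat) (hn : n%:R * tau <= T) :
  frob (fval (U n) - Uhat n)
    <= delta + n%:R * tau * eps1 + n%:R * tau / tau * eps2 /\
  delta + n%:R * tau * eps1 + n%:R * tau / tau * eps2
    <= delta + T * eps1 + T / tau * eps2.
Proof.
have NT0 : NT%:R != 0 :> R.
  by apply: contraTneq htau0 => NT0; rewrite htau NT0 invr0 mulr0 ltxx.
have TE : T = NT%:R * tau by rewrite htau mulrC divfK.
have nNT k : (k%:R * tau <= T) = (k <= NT)%N.
  by rewrite TE ler_pM2r// ler_nat.
split; last first.
  by rewrite -!addrA lerD2l lerD// ler_wpM2r// ler_pM2r ?invr_gt0.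
case: d hd => // m _ in Omegax Omegav hOmegax hOmegav E hE Mx Mv hMx hMv gx gv hg kind lloc
  lglob hflux hbound hCFL U hU0 hU Uhat hUhat h0 *.
have mO : measurable Omegax by apply: open_measurable_rv; case: hOmegax.
have [C alphaC] := hbound; have [boundary_upwind LF] := hflux.
have na_alpha t e z : 0 <= t <= T -> pface_set e z ->
    `|pdot (pnormal e) (velocity E t z)| <= dissipation E kind lloc lglob t e z.
  move=> tT ez; have [h1 h2] := LF t e z tT ez.
  by rewrite /dissipation; case ek : (kind e); [|exact: h1|exact: h2].
pose F t := Fh E (dissipation E kind lloc lglob) (separated_inflow gx gv) t.
have contract t V W : 0 <= t <= T ->
    frob ((V + tau *: F t V) - (W + tau *: F t W)) <= frob (V - W).
  move=> tT.
  have mE k : measurable_fun Omegax (fun x => E t x ord0 k).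
    by have [[c [[mEk _] _]] _] := hE t tT k.
  apply: (@euler_contraction R m Omegax Omegav Mx Mv hMx hMv E _ t C kind lloc lglob mE mO
    boundary_upwind (fun e z => na_alpha t e z tT) _ (fun e => hg t e tT) tau V W (ltW htau0)).
    by move=> e z ez; exact: le_trans (ler_norm _) (alphaC t e z tT ez).
  move=> K volK; apply: (tau_CFL_bound htau0 hCFL tT volK).
  apply: sumr_ge0 => e _; apply: (face_int_ge0 (e := e)) => z ez.
  exact: le_trans (normr_ge0 _) (na_alpha t e z tT ez).
move: hn; rewrite nNT mulfK ?gt_eqF//.
elim: n => [_|k IH kNT]; first by rewrite !mul0r !addr0.
have {}IH := IH (ltnW kNT).
have tT : 0 <= k%:R * tau <= T by apply/andP; split; [rewrite mulr_ge0// ltW|rewrite nNT ltnW].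
have step := SAT_step_error (ltW htau0) (hU k kNT).
rewrite hUhat// -/(F _); have ctr := contract _ (fval (U k)) (Uhat k) tT.
rewrite -/(F _) in step.
set V := fval (U k) + _ in step ctr; set W := Uhat k + _ in ctr *.
have -> : fval (U k.+1) - W = (fval (U k.+1) - V) + (V - W) by rewrite addrA subrK.
apply: le_trans (frobD _ _) _; apply: le_trans (lerD step (le_trans ctr IH)) _.
rewrite -natr1 le_eqVlt; apply/orP; left; apply/eqP; ring.
Qed.
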